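(* Let $d\ge1$ be an integer, let $\Omega=\{\boldsymbol{x}_1,\dots,\boldsymbol{x}_n\}$ be a set of $n$ vectors of $\mathbb{R}^d$, and let $\boldsymbol{L}_\varepsilon=[\kappa_\varepsilon(\boldsymbol{x}_i,\boldsymbol{x}_j)]_{i,j=1}^n$ for $\kappa$ a stationary kernel of smoothness order $r$ (possibly $r=\infty$). Then for all $m\le n$ of the form $m=\mathscr{P}_{k,d}$ with $k$ an integer, $0\le k\le r-1$, the fixed-size L-ensemble $\mathcal{X}_\varepsilon\sim|DPP|_m(\boldsymbol{L}_\varepsilon)$ has, as $\varepsilon\to0$ ($\varepsilon>0$), the limiting distribution $$\mathcal{X}_\star\sim|DPP|_m(\boldsymbol{V}_{\le k}\boldsymbol{V}_{\le k}^\top).$$ Equivalently, if $\boldsymbol{Q}$ is an orthonormal basis for (the column span of) $\boldsymbol{V}_{\le k}$, then $\mathcal{X}_\star\sim|DPP|_m(\boldsymbol{Q}\boldsymbol{Q}^\top)$.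
   Context: Kernel: a positive definite function $\kappa:\mathbb{R}^d\times\mathbb{R}^d\to\mathbb{R}$ (the matrix $[\kappa(\boldsymbol{y}_i,\boldsymbol{y}_j)]_{i,j}$ is positive definite for any finitely many distinct points). It is stationary if $\kappa(\boldsymbol{x},\boldsymbol{y})=f(\|\boldsymbol{x}-\boldsymbol{y}\|_2)$ for a function $f$; $f$ is assumed analytic in a neighbourhood of $0$, $f(t)=\sum_{i\ge0}f_it^i$, and $\kappa_\varepsilon(\boldsymbol{x},\boldsymbol{y})=f(\varepsilon\|\boldsymbol{x}-\boldsymbol{y}\|_2)$. Smoothness order: $r=\min\{r\ge1:f_{2r-1}\neq0\}$, with $r=\infty$ if all odd coefficients vanish. Polynomials: $\mathscr{P}_{k,d}=\binom{k+d}{d}$ is the dimension of the space of polynomials of degree $\le k$ in $d$ variables. $\boldsymbol{V}_{\le k}\in\mathbb{R}^{n\times\mathscr{P}_{k,d}}$ is the multivariate Vandermonde matrix, whose columns are the monomials $\boldsymbol{x}^{\boldsymbol\alpha}=\prod_i x_i^{\alpha_i}$ with $|\boldsymbol\alpha|=\sum_i\alpha_i\le k$, ordered by increasing degree (arbitrary order within a degree), evaluated at the $n$ points of $\Omega$. Fixed-size L-ensemble: for $\boldsymbol{L}$ positive semi-definite, $\mathcal{X}\sim|DPP|_m(\boldsymbol{L})$ is the random subset of $\Omega$ with $\mathbf{P}(\mathcal{X}=X)\propto\det(\boldsymbol{L}_X)$ if $|X|=m$, and $0$ otherwise ($\boldsymbol{L}_X$ is the principal submatrix indexed by $X$). Limiting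 distribution: $\mathbf{P}(\mathcal{X}_\varepsilon=X)\to\mathbf{P}(\mathcal{X}_\star=X)$ for every $X\subseteq\Omega$.
   Formalization: Added assumption: when d ≥ 2, k ≥ 2 and r = ∞, the Wronskian matrix of κ (Taylor coefficients of x^α y^β with |α|,|β| ≤ k) is nonsingular; without it the claim fails, e.g. for f = J_0 (Bessel) with d = k = 2. *)

(* Defs.v *)
From HB Require Import structures.
From mathcomp Require Import all_boot all_order all_algebra.
From mathcomp Require Import all_classical all_reals all_analysis.

Set Implicit Arguments.
Unset Strict Implicit.
Unset Printing Implicit Defensive.

Import Order.TTheory GRing.Theory Num.Theory.
Import numFieldNormedType.Exports.

Local Open Scope classical_set_scope.
Local Open Scope ring_scope.

(* The library norm on 'rV[R]_d is the sup norm. *)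
Definition enorm (R : realType) (d : nat) (v : 'rV[R]_d) : R :=
  Num.sqrt (\sum_l v 0 l ^+ 2).

Definition posdefmx (R : realType) (N : nat) (M : 'M[R]_N) : Prop :=
  M^T = M /\ forall v : 'rV[R]_N, v != 0 -> 0 < (v *m M *m v^T) 0 0.

Definition kernel_mx (R : realType) (d n : nat)
    (kappa : 'rV[R]_d -> 'rV[R]_d -> R) (x : 'I_n -> 'rV[R]_d) : 'M[R]_n :=
  \matrix_(i, j) kappa (x i) (x j).

Definition pd_kernel (R : realType) (d : nat)
    (kappa : 'rV[R]_d -> 'rV[R]_d -> R) : Prop :=
  forall (N : nat) (y : 'I_N -> 'rV[R]_d), injective y ->
    posdefmx (kernel_mx kappa y).

Definition stationary (R : realType) (d : nat)
    (kappa : 'rV[R]_d -> 'rV[R]_d -> R) (f : R -> R) : Prop :=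
  forall x y, kappa x y = f (enorm (x - y)).

Definition analytic_at0 (R : realType) (f : R -> R) (a : nat -> R) : Prop :=
  exists2 rho : R, 0 < rho &
    forall t : R, `|t| < rho -> pseries a t @ \oo --> f t.

(* [None] is the smoothness order r = +oo. *)
Definition smoothness_order (R : realType) (a : nat -> R) (r : option nat) :
    Prop :=
  match r with
  | Some s => [/\ (1 <= s)%N, a (2 * s - 1)%N != 0 &
                  forall s' : nat, (1 <= s' < s)%N -> a (2 * s' - 1)%N = 0]
  | None => forall s' : nat, (1 <= s')%N -> a (2 * s' - 1)%N = 0
  end.

Definition le_order_pred (k : nat) (r : option nat) : bool :=
  if r is Some s then (k <= s - 1)%N else true.

Definition scaled_kernel (R : realType) (d : nat) (f : R -> R) (eps : R)
    (x y : 'rV[R]_d) : R :=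
  f (eps * enorm (x - y)).

Definition polydim (k d : nat) : nat := 'C(k + d, d).

Definition mdegree (d : nat) (al : {ffun 'I_d -> nat}) : nat :=
  (\sum_l al l)%N.

(* An enumeration of the multi-indices of degree at most k by increasing
   degree; the order inside a degree is left free. *)
Definition graded_enum (k d : nat)
    (alpha : 'I_(polydim k d) -> {ffun 'I_d -> nat}) : Prop :=
  [/\ injective alpha,
      forall be : {ffun 'I_d -> nat},
        (mdegree be <= k)%N <-> exists j, alpha j = be &
      forall i j : 'I_(polydim k d),
        (i <= j)%N -> (mdegree (alpha i) <= mdegree (alpha j))%N].

Definition vandermonde (R : realType) (d n N : nat) (x : 'I_n -> 'rV[R]_d)
    (alpha : 'I_N -> {ffun 'I_d -> nat}) : 'M[R]_(n, N) :=
  \matrix_(i, j) \prod_l x i 0 l ^+ alpha j l.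

(* The coefficient of x^al y^be in the formal expansion of
   \sum_j a_(2j) |x - y|^(2j), that is, for a smooth kernel,
   (d/dx)^al (d/dy)^be kappa (0, 0) / (al! be!). With al + be = 2 ga it is
   a_(2|ga|) (|ga|! / ga!) \prod_l binom(al_l + be_l, al_l) (-1)^be_l,
   and it vanishes when some al_l + be_l is odd.
   Strict positive definiteness of kappa does not make this matrix nonsingular
   when r = +oo and d, k >= 2: for f = J_0 (Bessel) and d = k = 2,
   (Laplacian + 1) kappa = 0 and the flat limit is not |DPP|_6(V V^T). *)
Definition wronskian_coef (R : realType) (d : nat) (a : nat -> R)
    (al be : {ffun 'I_d -> nat}) : R :=
  if [forall l, ~~ odd (al l + be l)%N] then
    a (mdegree al + mdegree be)%N
    * (((mdegree al + mdegree be)%N./2)`!)%:R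
    / (\prod_l ((al l + be l)%N./2)`!)%N%:R
    * \prod_l ((-1) ^+ be l * 'C((al l + be l)%N, al l)%:R)
  else 0.

Definition wronskian (R : realType) (d N : nat) (a : nat -> R)
    (alpha : 'I_N -> {ffun 'I_d -> nat}) : 'M[R]_N :=
  \matrix_(i, j) wronskian_coef a (alpha i) (alpha j).

Definition principal_submx (R : realType) (n : nat) (L : 'M[R]_n)
    (X : {set 'I_n}) : 'M[R]_#|X| :=
  \matrix_(i, j) L (enum_val i) (enum_val j).

Definition is_law (R : realType) (n : nat) (p : {set 'I_n} -> R) : Prop :=
  (forall X, 0 <= p X) /\ \sum_X p X = 1.

(* p is the law of |DPP|_m(L), a random subset of the points indexed by 'I_n.
   As p sums to 1, this can only hold if some minor \det L_X, |X| = m, is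
   nonzero, i.e. if |DPP|_m(L) is well defined. *)
Definition fixed_size_L_ensemble (R : realType) (n : nat) (m : nat)
    (L : 'M[R]_n) (p : {set 'I_n} -> R) : Prop :=
  is_law p /\
  exists c : R, forall X : {set 'I_n},
    p X = if #|X| == m then c * \det (principal_submx L X) else 0.

Definition orthonormal_basis_of_colspan (R : realType) (n q N : nat)
    (Q : 'M[R]_(n, q)) (V : 'M[R]_(n, N)) : Prop :=
  Q^T *m Q = 1%:M /\ (Q^T == V^T)%MS.

(* Main.v *)
Require Import Defs.
From HB Require Import structures.
From mathcomp Require Import all_boot all_order all_algebra.
From mathcomp Require Import all_classical all_reals all_analysis.
From mathcomp Require Import zify ring lra.

Set Implicit Arguments.
Unset Strict Implicit.
Unset Printing Implicit Defensive.

Import Order.TTheory GRing.Theory Num.Theory.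
Import numFieldNormedType.Exports.

Local Open Scope classical_set_scope.
Local Open Scope ring_scope.

(** Since k < r, the odd Taylor coefficients of [f] vanish up to degree 2k, so
    f (eps |x - y|) is, up to O(eps^(2k+1)), the sum of the terms
    W_(al,be) eps^(|al|+|be|) x^al y^be with |al| + |be| <= 2k
    ([kernel_taylor]).  Put eps = t^2, let D be the diagonal matrix of the
    t^(2|al_j|), and take m points with Vandermonde matrix V.  Their kernel matrix is
    [V D | t^(2k+1) I] M [V D | t^(2k+1) I]^T, where M is bounded and has W as
    upper left block.  Expanding the determinant over the possible choices of
    columns on each side, every choice other than the columns of V D costs extra
    powers of t, whether or not V is singular, so that the determinant is
    eps^(2S) (det W det(V)^2 + o(1)) with S the sum of the |al_j|
    ([kernel_det_order]).  A fixed-size L-ensemble is a quotient of such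
    determinants; S and det W cancel in the quotient, and the limit follows as soon
    as det W is not 0 ([wronskian_unit]).

    Suppose that W v = 0 with v nonzero.  Evaluations at suitable points h z_i can be
    combined into a functional l_h which reads off the coefficients v at scale h
    ([dual_functionals], [scaled_weights]); its squared norm for the kernel is
    v^T W v + O(h) = O(h) ([scaled_gram_order]).

    If r is finite, pair l_h with a functional supported by the points t z_i, where
    h is a large power of t.  By Cauchy-Schwarz the pairing is O(t^p) with p large.
    On the other hand it has an expansion in powers of t ([cross_order]) in which
    the term a_(2r-1) |x|^(2r-1) of the kernel is the only one to reach a certain
    low order.  Its coefficient there is a_(2r-1) times a sum of squares weighted
    by Gegenbauer-type coefficients, all of one sign because the degree of v is
    less than r ([cross_gram_gt0]); so it is not 0, a contradiction
    ([wronskian_quad_neq0]).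

    If r is infinite and d = 1, positivity of the larger Wronskians forces v to be
    in the kernel of all of them, which is a linear recurrence of some order K for
    the numbers n! a_n.  Then the kernel matrix of any K + 1 points close to 0 is a
    limit of matrices of rank at most K, hence singular
    ([wronskian_dim1_nondegenerate]).  If r is infinite, d >= 2 and k <= 1, the
    Wronskian is diagonal, and its entries, multiples of a_0 and a_2, are nonzero
    by the case d = 1 applied on a line.  In the remaining case invertibility is a
    hypothesis.

    For the second claim, V = Q D^T for some D.  When one of the two ensembles
    exists, D is square and invertible, and the minors of the two matrices differ
    by the factor det(D)^2 ([ensemble_orthonormal]). *)

(** * Orders of vanishing at 0 from the right *)

(** Unlike a limit, this keeps track of exponents under products, sums and
    substitutions, and it asks nothing of [g] at 0 or on the left. *)
Definition order_at0 (R : realType) (n : nat) (g : R -> R) : Prop :=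
  exists C : R, \forall t \near 0^'+, `|g t| <= C * t ^+ n.

Lemma order_at0_ge0 (R : realType) n (g : R -> R) : order_at0 n g ->
  exists2 C : R, 0 <= C & \forall t \near 0^'+, `|g t| <= C * t ^+ n.
Proof.
move=> [C hC]; exists `|C| => //; near=> t.
apply: (@le_trans _ _ (C * t ^+ n)); first by near: t.
rewrite ler_wpM2r ?ler_norm // exprn_ge0 // ltW //; near: t; exact: nbhs_right_gt.
Unshelve. all: by end_near. Qed.

Lemma order_at0_near (R : realType) n (g g' : R -> R) :
  (\forall t \near 0^'+, g t = g' t) -> order_at0 n g -> order_at0 n g'.
Proof.
move=> e [C hC]; exists C; near=> t.
by rewrite -(near e t) //; near: t.
Unshelve. all: by end_near. Qed.

Lemma order_at0_le (R : realType) n (g g' : R -> R) :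
  (\forall t \near 0^'+, `|g t| <= `|g' t|) -> order_at0 n g' -> order_at0 n g.
Proof.
move=> h [C hC]; exists C; near=> t.
by apply: (@le_trans _ _ `|g' t|); near: t.
Unshelve. all: by end_near. Qed.

Lemma order_at0D (R : realType) n (g1 g2 : R -> R) : order_at0 n g1 -> order_at0 n g2 ->
  order_at0 n (fun t => g1 t + g2 t).
Proof.
move=> [C hC] [C' hC']; exists (C + C'); near=> t.
rewrite mulrDl (le_trans (ler_normD _ _))// lerD//; near: t => //.
Unshelve. all: by end_near. Qed.

Lemma order_at0N (R : realType) n (g1 : R -> R) : order_at0 n g1 ->
  order_at0 n (fun t => - g1 t).
Proof. by move=> [C hC]; exists C; near=> t; rewrite normrN; near: t.
Unshelve. all: by end_near. Qed.

Lemma order_at0M (R : realType) n n' (g1 g2 : R -> R) : order_at0 n g1 -> order_at0 n' g2 ->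
  order_at0 (n + n') (fun t => g1 t * g2 t).
Proof.
move=> [C hC] [C' hC']; exists (C * C'); near=> t.
rewrite exprD mulrACA normrM ler_pM//; near: t => //.
Unshelve. all: by end_near. Qed.

Lemma order_at0_cst (R : realType) (c : R) : order_at0 0 (fun=> c).
Proof. by exists `|c|; near=> t; rewrite expr0 mulr1.
Unshelve. all: by end_near. Qed.

Lemma order_at0X (R : realType) n : order_at0 n (fun t : R => t ^+ n).
Proof.
exists 1; near=> t; have t0 : 0 < t by near: t; exact: nbhs_right_gt.
by rewrite mul1r ger0_norm// exprn_ge0// ltW.
Unshelve. all: by end_near. Qed.

Lemma order_at0W (R : realType) n n' (g : R -> R) : (n <= n')%N ->
  order_at0 n' g -> order_at0 n g.
Proof.
move=> nn' /order_at0_ge0[C C0 hC]; exists C; near=> t.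
apply: (@le_trans _ _ (C * t ^+ n')); first by near: t.
have t0 : 0 < t by near: t; exact: nbhs_right_gt.
have t1 : t < 1 by near: t; exact: nbhs_right_lt.
by rewrite ler_wpM2l// ler_wiXn2l// ltW.
Unshelve. all: by end_near. Qed.

Lemma order_at0Z (R : realType) n (c : R) (g : R -> R) : order_at0 n g ->
  order_at0 n (fun t => c * g t).
Proof. by move=> hg; apply: (@order_at0M _ 0 n (fun=> c)) => //; apply: order_at0_cst. Qed.

Lemma order_at0_sum (R : realType) n (I : Type) (r : seq I) (P : pred I)
    (g : I -> R -> R) : (forall i, P i -> order_at0 n (g i)) ->
  order_at0 n (fun t => \sum_(i <- r | P i) g i t).
Proof.
move=> hg; elim: r => [|i r IH].
  by exists 0; near=> t; rewrite big_nil normr0 mul0r.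
case: (boolP (P i)) => Pi.
  apply: (order_at0_near _ (order_at0D (hg i Pi) IH)).
  by near=> t; rewrite big_cons Pi.
by apply: (order_at0_near _ IH); near=> t; rewrite big_cons (negPf Pi).
Unshelve. all: by end_near. Qed.

Lemma order_at0_pow (R : realType) n p (g : R -> R) : order_at0 n g ->
  order_at0 (p * n) (fun t => g t ^+ p).
Proof.
move=> hg; elim: p => [|p IH]; first exact: order_at0_cst.
rewrite mulSn; apply: (order_at0_near _ (order_at0M hg IH)).
by near=> t; rewrite exprS.
Unshelve. all: by end_near. Qed.

Lemma order_at0_prod (R : realType) (I : Type) (r : seq I) (P : pred I)
    (g : I -> R -> R) : (forall i, P i -> order_at0 0 (g i)) ->
  order_at0 0 (fun t => \prod_(i <- r | P i) g i t).
Proof.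
move=> hg; elim: r => [|i r IH].
  apply: (order_at0_near _ (order_at0_cst 1)); by near=> t; rewrite big_nil.
case: (boolP (P i)) => Pi.
  apply: (order_at0_near _ (order_at0M (hg i Pi) IH)).
  by near=> t; rewrite big_cons Pi.
by apply: (order_at0_near _ IH); near=> t; rewrite big_cons (negPf Pi).
Unshelve. all: by end_near. Qed.

Lemma order_at0_det (R : realType) n (A : R -> 'M[R]_n) :
  (forall i j, order_at0 0 (fun t => A t i j)) -> order_at0 0 (fun t => \det (A t)).
Proof.
move=> hA; apply: order_at0_sum => s _; apply: order_at0Z.
by apply: order_at0_prod => i _.
Qed.

Lemma order_at0_divX (R : realType) n m (g : R -> R) : order_at0 (n + m) g ->
  order_at0 m (fun t => g t / t ^+ n).
Proof.
move=> [C hC]; exists C; near=> t.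
have t0 : 0 < t by near: t; exact: nbhs_right_gt.
rewrite normrM normfV (gtr0_norm (exprn_gt0 _ t0)) ler_pdivrMr ?exprn_gt0//.
by rewrite -mulrA -exprD addnC; near: t.
Unshelve. all: by end_near. Qed.

Lemma powX_cvg0 (R : realType) p : (0 < p)%N -> t ^+ p @[t --> (0:R)^'+] --> (0:R)^'+.
Proof.
move=> p0 A [e /= e0 hA]; rewrite !near_simpl.
change (\forall t \near (0:R)^'+, A (t ^+ p)); near=> t.
have t0 : 0 < t by near: t; apply: nbhs_right_gt.
apply: hA; last by rewrite /= exprn_gt0.
rewrite /= sub0r normrN gtr0_norm ?exprn_gt0//.
have t1 : t < 1 by near: t; apply: nbhs_right_lt.
apply: le_lt_trans (_ : t < e).
  by rewrite -[leRHS]expr1 ler_wiXn2l// ltW.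
near: t; exact: nbhs_right_lt.
Unshelve. all: by end_near. Qed.

Lemma sqrt_cvg0 (R : realType) : Num.sqrt t @[t --> (0:R)^'+] --> (0:R)^'+.
Proof.
move=> A [e /= e0 hA]; rewrite !near_simpl.
change (\forall t \near (0:R)^'+, A (Num.sqrt t)); near=> t.
have t0 : 0 < t by near: t; apply: nbhs_right_gt.
apply: hA; last by rewrite /= sqrtr_gt0.
rewrite /= sub0r normrN ger0_norm ?sqrtr_ge0//.
rewrite -[ltRHS](gtr0_norm e0) -sqrtr_sqr ltr_sqrt ?exprn_gt0//.
by near: t; apply: nbhs_right_lt; rewrite exprn_gt0.
Unshelve. all: by end_near. Qed.

Lemma order_at0_comp (R : realType) n p (g : R -> R) : (0 < p)%N -> order_at0 n g ->
  order_at0 (p * n) (fun t => g (t ^+ p)).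
Proof.
move=> p0 [C hC]; exists C.
under eq_near do rewrite exprM.
exact: (powX_cvg0 p0 hC).
Qed.

Lemma order_at0_cvg (R : realType) (g : R -> R) (c : R) : order_at0 1 (fun t => g t - c) ->
  g t @[t --> 0^'+] --> c.
Proof.
move=> /order_at0_ge0[C C0 hC]; apply/cvgrPdist_le => e e0; near=> t.
rewrite distrC; apply: (@le_trans _ _ (C * t ^+ 1)); first by near: t.
rewrite expr1; apply: (@le_trans _ _ ((C + 1) * t)).
  rewrite ler_wpM2r ?lerDl//; apply/ltW; near: t; exact: nbhs_right_gt.
rewrite mulrC -ler_pdivlMr ?ltr_wpDl//; apply/ltW; near: t.
by apply: nbhs_right_lt; rewrite divr_gt0// ltr_wpDl.
Unshelve. all: by end_near. Qed.

Lemma order_at0_cvg_ge0 (R : realType) (F : R -> R) (c : R) :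
  order_at0 1 (fun t => F t - c) -> (\forall t \near 0^'+, 0 <= F t) -> 0 <= c.
Proof.
move=> /order_at0_cvg h F0; rewrite -(cvg_lim _ h)//.
by apply: limr_ge => //; apply/cvg_ex; exists c.
Qed.

(** A polynomial O(t^n) at 0 vanishes at 0; dividing by the variable lowers n. *)
Lemma order_at0_poly (R : realType) n (p : {poly R}) : order_at0 n (fun t => p.[t]) ->
  forall i, (i < n)%N -> p`_i = 0.
Proof.
elim: n p => // n IH p hp i.
have p0 : p`_0 = 0.
  have h1 : p.[t] @[t --> (0:R)^'+] --> p.[0].
    by apply: cvg_at_right_filter; apply: continuous_horner.
  have h2 : p.[t] @[t --> (0:R)^'+] --> (0:R).
    apply: order_at0_cvg; apply: (order_at0W (ltn0Sn n)).
    by apply: (order_at0_near _ hp); near=> t; rewrite subr0.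
  by rewrite -horner_coef0; apply: (cvg_unique _ h1 h2).
case: i => // i hi.
have /factor_theorem[q pq] : root p 0 by rewrite /root horner_coef0 p0.
rewrite subr0 in pq.
rewrite pq coefMX /=; apply: IH => //.
case: hp => C hC; exists C; near=> t.
have t0 : 0 < t by near: t; apply: nbhs_right_gt.
rewrite -(ler_pM2r t0) -mulrA -exprSr.
have -> : `|q.[t]| * t = `|p.[t]|.
  by rewrite pq hornerM hornerX normrM (gtr0_norm t0).
near: t; exact: hC.
Unshelve. all: by end_near. Qed.

(** * Taylor remainders: analytic functions and real powers *)

(** Convergence at a point makes the terms of the series bounded there, which gives
    geometric bounds on any smaller disc. *)
Lemma analytic_coef_bound (R : realType) (f : R -> R) (a : nat -> R) :
  analytic_at0 f a -> exists M rho : R, [/\ 0 < rho, 0 <= M,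
    forall n, `|a n| * rho ^+ n <= M &
    forall t, `|t| < rho -> pseries a t @ \oo --> f t].
Proof.
move=> [rho rho0 h].
have r2 : 0 < rho / 2 by rewrite divr_gt0.
have r2' : `|rho / 2| < rho by rewrite gtr0_norm// ltr_pdivrMr// ltr_pMr// ltr1n.
have /cvg_series_bounded hb : cvgn (pseries a (rho / 2)) by apply/cvg_ex; eexists; exact: h.
have [M M0 hM] := pinfty_ex_gt0 hb.
exists M, (rho / 2); split => //; first exact: ltW.
  by move=> n; have := hM n I; rewrite /= normrM normrX (gtr0_norm r2).
by move=> t ht; apply: h; apply: lt_trans ht _; rewrite -(gtr0_norm r2).
Qed.

Lemma geom_tail_le (R : realType) (q : R) N n : 0 <= q <= 2^-1 ->
  \sum_(N <= i < n) q ^+ i <= 2 * q ^+ N.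
Proof.
move=> /andP[q0 q1].
have q0N : 0 <= q ^+ N by rewrite exprn_ge0.
elim: n N q0N => [|n IH] N qN; first by rewrite big_geq// mulr_ge0.
case: (ltnP N n.+1) => hN; last by rewrite big_geq ?mulr_ge0.
rewrite big_nat_recl // ?big_add1 /=.
under eq_bigr do rewrite exprS.
rewrite -mulr_sumr.
have := IH _ qN => h.
have : q * \sum_(N <= i < n) q ^+ i <= 2^-1 * (2 * q ^+ N).
  by apply: ler_pM => //; apply: sumr_ge0 => i _; rewrite exprn_ge0.
lra.
Qed.

Lemma analytic_remainder (R : realType) (f : R -> R) (a : nat -> R) (N : nat) :
  analytic_at0 f a -> exists C delta : R, [/\ 0 < delta, 0 <= C &
    forall t, `|t| <= delta ->
     `|f t - \sum_(i < N) a i * t ^+ i| <= C * `|t| ^+ N].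
Proof.
move=> /analytic_coef_bound[M [rho [r0 M0 hM hf]]].
exists (2 * M / rho ^+ N), (rho / 2); split.
- by rewrite divr_gt0.
- by rewrite !mulr_ge0// invr_ge0 exprn_ge0// ltW.
move=> t ht.
have tr : `|t| < rho by apply: le_lt_trans ht _; rewrite ltr_pdivrMr// ltr_pMr// ltr1n.
have hc : `|pseries a t n - \sum_(i < N) a i * t ^+ i| @[n --> \oo]
          --> `|f t - \sum_(i < N) a i * t ^+ i|.
  by apply: cvg_norm; apply: cvgB; [exact: hf | exact: cvg_cst].
rewrite -(cvg_lim _ hc)//; apply: limr_le; first by apply/cvg_ex; eexists; exact: hc.
exists N => // n /= Nn.
rewrite /pseries /series /= -(big_mkord xpredT (fun i => a i * t ^+ i)).
rewrite (@big_cat_nat _ _ _ N)//= addrAC subrr add0r.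
apply: (le_trans (ler_norm_sum _ _ _)).
have q0 : 0 <= `|t| / rho <= 2^-1.
  by apply/andP; split; [rewrite divr_ge0// ltW | rewrite ler_pdivrMr// mulrC].
have hq i : `|a i * t ^+ i| <= M * (`|t| / rho) ^+ i.
  rewrite normrM normrX expr_div_n mulrA -mulrAC ler_wpM2r ?exprn_ge0//.
  by rewrite ler_pdivlMr ?exprn_gt0.
apply: (le_trans (ler_sum _ (fun i _ => hq i))).
rewrite -mulr_sumr; apply: (le_trans (ler_wpM2l M0 (geom_tail_le N n q0))).
by rewrite expr_div_n mulrA [leRHS]mulrAC mulrA [M * 2]mulrC.
Qed.

Lemma analytic_order (R : realType) (f : R -> R) (a : nat -> R) (N : nat)
    (e : R -> R) (b : R) :
  analytic_at0 f a -> (\forall h \near 0^'+, 0 <= e h <= b) ->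
  order_at0 N (fun h => f (h * e h) - \sum_(i < N) a i * (h * e h) ^+ i).
Proof.
move=> /(analytic_remainder N)[C [delta [d0 C0 hC]]] he.
exists (C * `|b| ^+ N); near=> h.
have h0 : 0 < h by near: h; exact: nbhs_right_gt.
have /andP[e0 eb] : 0 <= e h <= b by near: h.
have b0 : 0 <= b := le_trans e0 eb.
have hb : `|h * e h| <= h * b by rewrite ger0_norm ?mulr_ge0 ?ler_wpM2l// ltW.
apply: le_trans (hC _ _) _; last first.
  rewrite -mulrA ler_wpM2l// -exprMn [leRHS](_ : _ = (h * b) ^+ N).
    by rewrite lerXn2r// nnegrE ?mulr_ge0// ltW.
  by rewrite (ger0_norm b0) mulrC.
apply: (le_trans hb); apply: (@le_trans _ _ (h * (b + 1))).
  by rewrite ler_wpM2l ?lerDl// ltW.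
rewrite -ler_pdivlMr ?ltr_wpDl//; apply/ltW; near: h.
apply: nbhs_right_lt; rewrite divr_gt0//.
near (0 : R)^'+ => t.
have /andP[e0 eb] : 0 <= e t <= b by near: t.
by rewrite ltr_wpDl// (le_trans e0).
Unshelve. all: by end_near. Qed.

Definition gbinom (R : realType) (s : R) (n : nat) : R :=
  (\prod_(i < n) (s - i%:R)) / (n`!)%:R.

Lemma gbinom0 (R : realType) (s : R) : gbinom s 0 = 1.
Proof. by rewrite /gbinom big_ord0 fact0 divr1. Qed.

Lemma gbinomS (R : realType) (s : R) n :
  gbinom s n.+1 *+ n.+1 = s * gbinom (s - 1) n.
Proof.
rewrite /gbinom big_ord_recl subr0 factS natrM invfM -mulr_natr.
under eq_bigr => i _.
  have -> : s - (lift ord0 i)%:R = s - 1 - i%:R by rewrite lift0 -natr1; ring.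
  over.
by field; rewrite pnatr_eq0 -lt0n fact_gt0 nat1r pnatr_eq0.
Qed.

(** All the factors s, s - 1, ..., s - n + 1 are positive.  With s = r - 1/2 this
    covers every n <= r, and it is here that the restriction k < r enters the
    treatment of the first odd coefficient. *)
Lemma gbinom_gt0 (R : realType) (s : R) n : n%:R < s + 1 -> 0 < gbinom s n.
Proof.
move=> ns; rewrite divr_gt0 ?ltr0n ?fact_gt0// prodr_gt0// => i _.
have : (i.+1%:R : R) <= n%:R by rewrite ler_nat.
rewrite -natr1; lra.
Qed.

Lemma powR_bound (R : realType) (s y : R) : 2^-1 <= y <= 2 ->
  0 <= y `^ s <= expR (`|s| * ln 2).
Proof.
move=> /andP[y1 y2]; rewrite powR_ge0 /=.
have y0 : 0 < y by apply: lt_le_trans y1; rewrite invr_gt0.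
rewrite /powR gt_eqF// ler_expR.
apply: (le_trans (ler_norm _)); rewrite normrM ler_wpM2l//.
rewrite ler_norml -lnV ?posrE// !ler_ln ?posrE ?invr_gt0//.
by rewrite y1 y2.
Qed.

(** Induction on n for all s at once: the derivative of the remainder of order n + 1
    for the exponent s is s times the remainder of order n for s - 1, and the mean
    value theorem integrates the bound. *)
Lemma powR_taylor (R : realType) (s : R) n : exists2 C : R, 0 <= C &
  forall w : R, `|w| <= 2^-1 ->
    `|(1 + w) `^ s - \sum_(i < n) gbinom s i * w ^+ i| <= C * `|w| ^+ n.
Proof.
elim: n s => [|n IH] s.
  exists (expR (`|s| * ln 2)); first exact: expR_ge0.
  move=> w; rewrite ler_norml => /andP[w1 w2]; rewrite big_ord0 subr0 expr0 mulr1.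
  have /(powR_bound s)/andP[h1 h2] : 2^-1 <= 1 + w <= 2 by lra.
  by rewrite ger0_norm.
have [C C0 hC] := IH (s - 1).
exists (`|s| * C); first exact: mulr_ge0.
move=> w hw.
pose p : {poly R} := \poly_(i < n.+1) gbinom s i.
pose g y := y `^ s - (p \Po ('X - 1%:P)).[y].
pose dg y := s * y `^ (s - 1) - (p^`() \Po ('X - 1%:P)).[y].
have gE v : g (1 + v) = (1 + v) `^ s - \sum_(i < n.+1) gbinom s i * v ^+ i.
  by rewrite /g horner_comp !hornerE addrAC subrr add0r horner_poly.
have dgE v : dg (1 + v) =
    s * ((1 + v) `^ (s - 1) - \sum_(i < n) gbinom (s - 1) i * v ^+ i).
  have e1 : (1 + v) - 1 = v by rewrite addrAC subrr add0r.
  rewrite /dg horner_comp hornerD hornerN hornerX hornerC e1 [RHS]mulrBr.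
  congr (_ - _).
  have -> : p^`() = \poly_(i < n) (gbinom s i.+1 *+ i.+1).
    apply/polyP => i; rewrite coef_deriv !coef_poly ltnS.
    by case: ifP => // _; rewrite mul0rn.
  by rewrite horner_poly mulr_sumr; apply: eq_bigr => i _; rewrite gbinomS -mulrA.
have g1 : g 1 = 0.
  rewrite -[1]addr0 gE addr0 powR1 big_ord_recl gbinom0 expr0 mulr1 big1 ?addr0 ?subrr//.
  by move=> i _; rewrite lift0 expr0n mulr0.
have isd (y : R) : 0 < y -> is_derive y 1 g (dg y).
  move=> y0; have hp := is_derive_poly (p \Po ('X - 1%:P)) y.
  have hs := is_derive1_powR s y0.
  have := is_deriveB hs hp.
  by rewrite deriv_comp derivB derivX derivC subr0 mulr1.
have key (v : R) : 0 <= `|v| <= `|w| -> `|dg (1 + v)| <= `|s| * C * `|w| ^+ n.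
  move=> /andP[_ vw]; rewrite dgE normrM -mulrA ler_wpM2l//.
  apply: (le_trans (hC v (le_trans vw hw))).
  by rewrite ler_wpM2l// lerXn2r// nnegrE.
have hw' : - 2^-1 <= w <= 2^-1 by rewrite -ler_norml.
have cont (a b : R) : 0 < a -> {within `[a, b], continuous g}.
  move=> a0; apply: derivable_within_continuous => y; rewrite in_itv /= => /andP[ay _].
  have hd := isd y (lt_le_trans a0 ay). by apply: ex_derive.
have key2 (c : R) : Num.min 1 (1 + w) <= c <= Num.max 1 (1 + w) ->
    `|dg c * w| <= `|s| * C * `|w| ^+ n.+1.
  move=> hc; rewrite normrM exprSr mulrA ler_wpM2r//.
  rewrite -[c](subrKC 1); apply: key; rewrite normr_ge0/=.
  move: hc; rewrite minEle maxEle lerDl; case: (leP 0 w) => w0 /andP[c1 c2].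
    by rewrite ger0_norm ?subr_ge0// (ger0_norm w0); lra.
  by rewrite ler0_norm ?subr_le0// (ltr0_norm w0); lra.
rewrite -gE -[g _]subr0 -g1.
case: (leP 0 w) => w0.
  have [|c||c + ->] := @MVT_segment R g dg 1 (1 + w).
  - by rewrite lerDl.
  - by rewrite in_itv/= => /andP[c1 _]; apply: isd; apply: lt_trans c1.
  - exact: cont.
  rewrite in_itv/= => hc; rewrite addrAC subrr add0r; apply: key2.
  by rewrite minEle maxEle lerDl w0.
have y0 : 0 < 1 + w by lra.
have [|c||c + e] := @MVT_segment R g dg (1 + w) 1.
- by rewrite gerDl ltW.
- by rewrite in_itv/= => /andP[c1 _]; apply: isd; apply: lt_trans c1.
- exact: cont.
rewrite in_itv/= => hc; rewrite distrC e opprD addrA subrr sub0r mulrN normrN -?mulNr; apply: key2.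
by rewrite minEle maxEle lerDl (leNgt 0 w) w0.
Qed.

(** * The even Taylor part of the kernel as a sum of monomials *)

Lemma fact_neq0 (R : realType) n : (n`!)%:R != 0 :> R.
Proof. by rewrite pnatr_eq0 -lt0n fact_gt0. Qed.

(** The product of the series exp (s_l X) is exp of the sum; only coefficients up
    to the degree M where the factors are truncated are compared. *)
Lemma exp_coef_prod (R : realType) (L : Type) (r : seq L) (P : L -> {poly R})
    (s : L -> R) (M : nat) :
  (forall l j, (j <= M)%N -> (P l)`_j = s l ^+ j / (j`!)%:R) ->
  forall j, (j <= M)%N ->
    (\prod_(l <- r) P l)`_j = (\sum_(l <- r) s l) ^+ j / (j`!)%:R.
Proof.
move=> hP; elim: r => [|l r IH] j jM.
  rewrite !big_nil coef1; case: j jM => [|j] _; first by rewrite expr0 fact0 divr1.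
  by rewrite expr0n mul0r.
rewrite !big_cons coefM addrC exprDn mulr_suml; apply: eq_bigr => i _.
have ij : (i <= j)%N by rewrite -ltnS ltn_ord.
rewrite hP ?(leq_trans ij)// IH; last by rewrite (leq_trans _ jM)// leq_subr.
rewrite -[_ *+ 'C(j, i)]mulr_natr -(bin_fact ij) !natrM; field.
by rewrite !fact_neq0 pnatr_eq0 -lt0n bin_gt0 ij.
Qed.

(** One expansion that yields both the multinomial theorem and the Wronskian
    coefficients: [phi l] splits s_l^j / j! into pieces indexed by [T], and [dg] is
    the degree at which a piece contributes. *)
Lemma exp_sum_expand (R : realType) (d : nat) (T : finType) (dg : T -> nat)
    (phi : 'I_d -> T -> R) (s : 'I_d -> R) (M : nat) :
  (forall l j, (j <= M)%N ->
     \sum_(tau | dg tau == j) phi l tau = s l ^+ j / (j`!)%:R) ->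
  forall j, (j <= M)%N ->
    \sum_(theta : {ffun 'I_d -> T} | (\sum_l dg (theta l) == j)%N)
      \prod_l phi l (theta l) = (\sum_l s l) ^+ j / (j`!)%:R.
Proof.
move=> hphi j jM.
(* the generating polynomial of the pieces of the coordinate l *)
pose P l : {poly R} := \sum_tau phi l tau *: 'X^(dg tau).
rewrite -(@exp_coef_prod _ _ _ P s M _ j jM); last first.
  move=> l i iM; rewrite -hphi// coef_sum [RHS]big_mkcond; apply: eq_bigr => tau _.
  by rewrite coefZ coefXn eq_sym; case: eqP; rewrite ?mulr1 ?mulr0.
rewrite bigA_distr_bigA coef_sum big_mkcond; apply: eq_bigr => theta _.
rewrite scaler_prod prodrXr coefZ coefXn eq_sym.
by case: eqP; rewrite ?mulr1 ?mulr0.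
Qed.

Definition monomial (R : realType) (d : nat) (x : 'rV[R]_d) (al : {ffun 'I_d -> nat}) : R :=
  \prod_l x 0 l ^+ al l.

(** Multi-indices with bounded entries form a finite type, over which one can sum. *)
Definition unbox (d B : nat) (al : {ffun 'I_d -> 'I_B}) : {ffun 'I_d -> nat} :=
  [ffun l => al l : nat].

Definition box (d B : nat) (al : {ffun 'I_d -> nat}) : {ffun 'I_d -> 'I_B.+1} :=
  [ffun l => inord (al l)].

Lemma entry_le_mdegree d (al : {ffun 'I_d -> nat}) l : (al l <= mdegree al)%N.
Proof. by rewrite /mdegree (bigD1 l)//= leq_addr. Qed.

Lemma boxK d B (al : {ffun 'I_d -> nat}) : (mdegree al <= B)%N -> unbox (box B al) = al.
Proof.
move=> h; apply/ffunP => l; rewrite !ffunE inordK// ltnS.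
exact: leq_trans (entry_le_mdegree _ _) h.
Qed.

Lemma unboxK d B (al : {ffun 'I_d -> 'I_B.+1}) : box B (unbox al) = al.
Proof. by apply/ffunP => l; rewrite !ffunE inord_val. Qed.

Lemma multinomial (R : realType) (d B : nat) (s : 'I_d -> R) j : (j < B)%N ->
  (\sum_l s l) ^+ j = \sum_(ga : {ffun 'I_d -> 'I_B} | mdegree (unbox ga) == j)
    (j`!)%:R / (\prod_l (ga l)`!)%:R * \prod_l s l ^+ ga l.
Proof.
case: B => // B jB.
have h := @exp_sum_expand R d 'I_B.+1 (@nat_of_ord _)
  (fun l c => s l ^+ c / (c`!)%:R) s B _ j jB.
rewrite -[LHS](divfK (fact_neq0 R j)) -h; last first.
  move=> l i iB; rewrite (big_pred1 (inord i)) ?inordK//.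
  by move=> c /=; rewrite -val_eqE/= inordK.
rewrite mulr_suml; apply: eq_big => [ga|ga _].
  by congr (_ == _); apply: eq_bigr => l _; rewrite ffunE.
by rewrite big_split/= prodfV natr_prod; ring.
Qed.

Lemma binom_pairs (R : realType) (x y : R) (B n : nat) : (n < B)%N ->
  \sum_(p : 'I_B * 'I_B | (p.1 + p.2)%N == n)
    (-1) ^+ p.2 * 'C((p.1 + p.2)%N, p.1)%:R * x ^+ p.1 * y ^+ p.2 = (x - y) ^+ n.
Proof.
case: B => // B nB.
pose F a b : R := (-1) ^+ b * 'C((a + b)%N, a)%:R * x ^+ a * y ^+ b.
rewrite -(pair_big_dep xpredT (fun a b : 'I_B.+1 => (a + b)%N == n)
  (fun a b : 'I_B.+1 => F a b)) /=.
transitivity (\sum_(a < B.+1 | (a < n.+1)%N) F a (n - a)%N).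
  rewrite [RHS]big_mkcond; apply: eq_bigr => a _; case: ifP => an.
    rewrite (big_pred1 (inord (n - a))) ?inordK//; first lia.
    by move=> c /=; rewrite -val_eqE/= inordK; lia.
  by rewrite big_pred0// => c; lia.
rewrite -(big_ord_widen _ (fun a => F a (n - a)%N))// addrC exprDn.
apply: eq_bigr => i _; have ij : (i <= n)%N by rewrite -ltnS.
rewrite /F subnKC// (exprNn y) -[RHS]mulr_natr; move: (n - i)%N => b; ring.
Qed.

(** The exponential of the sum of the (x_l - y_l)^2 factors over the coordinates, and
    in each coordinate (x_l - y_l)^(2c) / c! is expanded by the binomial theorem.
    The pieces are pairs of exponents (p, q) placed at degree (p + q) / 2, with
    coefficient 0 when p + q is odd. *)
Lemma wronskian_coef_expand (R : realType) (d k i : nat) (a : nat -> R)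
    (x y : 'rV[R]_d) : (i <= k)%N ->
  a (2 * i)%N * (\sum_l (x 0 l - y 0 l) ^+ 2) ^+ i =
  \sum_(al : {ffun 'I_d -> 'I_(2 * k).+1}) \sum_(be : {ffun 'I_d -> 'I_(2 * k).+1} |
      (mdegree (unbox al) + mdegree (unbox be) == 2 * i)%N)
    wronskian_coef a (unbox al) (unbox be) * monomial x (unbox al)
      * monomial y (unbox be).
Proof.
move=> ik; set B := (2 * k).+1.
pose T := ('I_B * 'I_B)%type.
pose dg (p : T) := (p.1 + p.2)./2.
pose phi l (p : T) : R := if odd (p.1 + p.2) then 0 else
  (-1) ^+ p.2 * 'C((p.1 + p.2)%N, p.1)%:R * x 0 l ^+ p.1 * y 0 l ^+ p.2
   / (((p.1 + p.2)./2)`!)%:R.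
have hphi l j : (j <= k)%N ->
    \sum_(p | dg p == j) phi l p = ((x 0 l - y 0 l) ^+ 2) ^+ j / (j`!)%:R.
  move=> jk; rewrite -exprM -(@binom_pairs R _ _ B); last by rewrite ltnS leq_mul2l.
  rewrite mulr_suml big_mkcond [RHS]big_mkcond; apply: eq_bigr => p _.
  rewrite /dg /phi; case: (boolP (odd (p.1 + p.2))) => hodd.
    by rewrite if_same; case: eqP => // e; rewrite e oddM in hodd.
  have -> : ((p.1 + p.2)%N == (2 * j)%N) = ((p.1 + p.2)./2 == j).
    by rewrite -{1}[(p.1 + p.2)%N]even_halfK// mul2n -!muln2 eqn_pmul2r.
  by case: eqP => // <-.
have h := exp_sum_expand hphi ik.
rewrite -[(\sum_l _) ^+ i](divfK (fact_neq0 R i)) -h.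
rewrite pair_big_dep /= (reindex (fun th : {ffun 'I_d -> T} =>
   ([ffun l => (th l).1] : {ffun 'I_d -> 'I_B}, [ffun l => (th l).2] : {ffun 'I_d -> 'I_B}))) /=;
  last first.
  exists (fun p : {ffun 'I_d -> 'I_B} * {ffun 'I_d -> 'I_B} => [ffun l => (p.1 l, p.2 l)]) => [th|[p q]] _ /=.
    by apply/ffunP => l; rewrite !ffunE; case: (th l).
  by congr pair; apply/ffunP => l; rewrite !ffunE.
rewrite mulr_suml mulr_sumr big_mkcond [RHS]big_mkcond; apply: eq_bigr => th _.
have e1 : unbox [ffun l => (th l).1] = [ffun l => (th l).1 : nat].
  by apply/ffunP => l; rewrite !ffunE.
have e2 : unbox [ffun l => (th l).2] = [ffun l => (th l).2 : nat].
  by apply/ffunP => l; rewrite !ffunE.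
rewrite e1 e2 /wronskian_coef /monomial /mdegree -big_split /=.
case: (boolP [forall l, _]) => hev.
  have hl l : ~~ odd ((th l).1 + (th l).2) by move/forallP: hev => /(_ l); rewrite !ffunE.
  have -> : (\sum_l ([ffun l0 => (th l0).1 : nat] l + [ffun l0 => (th l0).2 : nat] l) =
      2 * \sum_l dg (th l))%N.
    rewrite big_distrr /=; apply: eq_bigr => l _; rewrite !ffunE /dg.
    by rewrite mul2n even_halfK.
  rewrite eqn_pmul2l//; case: eqP => // ->.
  rewrite [(2 * i)%N]mulnC muln2 doubleK -mulrA -mulrA -!big_split/= natr_prod -prodfV.
  rewrite -[RHS]mulrA -big_split/=.
  under [X in _ = _ * X]eq_bigr => l _.
    rewrite !ffunE; have -> : forall u v w z t : R, u * (v * w * (z * t)) = v * w * z * t * u.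
      by move=> *; ring.
    over.
  rewrite [RHS]mulrAC mulrA; congr (_ * _ * _); apply: eq_bigr => l _.
  by rewrite /phi (negPf (hl l)).
move: hev; rewrite negb_forall => /existsP[l]; rewrite negbK !ffunE => hl.
have p0 : phi l (th l) = 0 by rewrite /phi hl.
have -> : \prod_(l < d) phi l (th l) = 0 by rewrite (bigD1 l)//= p0 mul0r.
by rewrite !mul0r mulr0 !if_same.
Qed.

Lemma wronskian_coef_odd (R : realType) (d : nat) (a : nat -> R)
    (al be : {ffun 'I_d -> nat}) :
  odd (mdegree al + mdegree be) -> wronskian_coef a al be = 0.
Proof.
rewrite /wronskian_coef; case: ifP => // /forallP hev.
rewrite /mdegree -big_split/= => /negPn; case/negP.
by apply: (big_ind (fun n => ~~ odd n)) => // m n /negPf em /negPf en; rewrite oddD em en.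
Qed.

Lemma smooth_odd_coef (R : realType) (a : nat -> R) (r : option nat) (k J : nat) :
  smoothness_order a r -> le_order_pred k r -> odd J -> (J <= 2 * k)%N -> a J = 0.
Proof.
move=> hr hk oJ Jk; have -> : J = (2 * (J.+1)./2 - 1)%N.
  by rewrite mul2n even_halfK /= ?negbK// subn1.
have J1 : (0 < (J.+1)./2)%N by case: J oJ {Jk}.
case: r hr hk => [s|] /= hr hk; last exact: hr.
case: hr => s1 _; apply; rewrite J1 /=; lia.
Qed.

Lemma enorm_ge0 (R : realType) d (v : 'rV[R]_d) : 0 <= enorm v.
Proof. exact: sqrtr_ge0. Qed.

Lemma enorm_sqr (R : realType) d (v : 'rV[R]_d) : enorm v ^+ 2 = \sum_l v 0 l ^+ 2.
Proof. by rewrite sqr_sqrtr// sumr_ge0// => l _; rewrite sqr_ge0. Qed.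

Lemma enormZ (R : realType) d (h : R) (v : 'rV[R]_d) : 0 <= h ->
  enorm (h *: v) = h * enorm v.
Proof.
move=> h0; rewrite /enorm -[in RHS](ger0_norm h0) -sqrtr_sqr -sqrtrM ?sqr_ge0//.
by congr Num.sqrt; rewrite mulr_sumr; apply: eq_bigr => l _; rewrite mxE exprMn.
Qed.

Lemma enormBC (R : realType) d (x y : 'rV[R]_d) : enorm (x - y) = enorm (y - x).
Proof. by congr Num.sqrt; apply: eq_bigr => l _; rewrite !mxE -sqrrN opprB. Qed.

Lemma even_odd_sum (R : realType) (F : nat -> R) k :
  (forall J, odd J -> (J <= 2 * k)%N -> F J = 0) ->
  \sum_(J < (2 * k).+1) F J = \sum_(i < k.+1) F (2 * i)%N.
Proof.
elim: k => [|k IH] hF; first by rewrite muln0 !big_ord1 muln0.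
have o1 : F (2 * k).+1 = 0 by apply: hF; [rewrite /= oddM | lia].
have e : (2 * k.+1 = (2 * k).+2)%N by rewrite mulnS.
rewrite [RHS]big_ord_recr /= -IH; last by move=> J oJ hJ; apply: hF => //; lia.
by rewrite e big_ord_recr big_ord_recr /= o1 addr0.
Qed.

Lemma sum_half_index (R : realType) (c : R) N k : (odd N -> c = 0) -> (N <= 2 * k)%N ->
  \sum_(i < k.+1 | N == (2 * i)%N) c = c.
Proof.
move=> hc hN; case: (boolP (odd N)) => ho; first by rewrite hc// big1.
have hh : (2 * N./2)%N = N by rewrite mul2n even_halfK.
have hlt : (N./2 < k.+1)%N by rewrite ltnS -(leq_pmul2l (ltn0Sn 1)) hh.
rewrite (big_pred1 (inord N./2))// => i.
by rewrite /= -{1}hh eqn_pmul2l// -val_eqE/= inordK// eq_sym.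
Qed.

(** Smoothness of order greater than k leaves only even powers of the distance up to
    degree 2k, and these are polynomials in x and y. *)
Lemma kernel_taylor (R : realType) (d k : nat) (f : R -> R) (a : nat -> R)
    (r : option nat) (x y : 'rV[R]_d) :
  analytic_at0 f a -> smoothness_order a r -> le_order_pred k r ->
  order_at0 (2 * k).+1 (fun h => f (h * enorm (x - y)) -
   \sum_(al : {ffun 'I_d -> 'I_(2 * k).+1})
     \sum_(be : {ffun 'I_d -> 'I_(2 * k).+1} |
       (mdegree (unbox al) + mdegree (unbox be) <= 2 * k)%N)
    wronskian_coef a (unbox al) (unbox be) *
      h ^+ (mdegree (unbox al) + mdegree (unbox be)) *
      monomial x (unbox al) * monomial y (unbox be)).
Proof.
move=> hf hr hk; apply: (order_at0_near _ (@analytic_order _ _ _ (2 * k).+1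
  (fun=> enorm (x - y)) (enorm (x - y)) hf _)); last first.
  by near=> h; rewrite enorm_ge0 lexx.
near=> h; congr (_ - _).
rewrite (@even_odd_sum _ (fun J => a J * (h * enorm (x - y)) ^+ J)); last first.
  by move=> J oJ Jk; rewrite (smooth_odd_coef hr hk)// mul0r.
transitivity (\sum_(i < k.+1) \sum_(al : {ffun 'I_d -> 'I_(2 * k).+1})
     \sum_(be : {ffun 'I_d -> 'I_(2 * k).+1} |
       (mdegree (unbox al) + mdegree (unbox be) == 2 * i)%N)
    wronskian_coef a (unbox al) (unbox be) *
      h ^+ (mdegree (unbox al) + mdegree (unbox be)) *
      monomial x (unbox al) * monomial y (unbox be)).
  apply: eq_bigr => i _; rewrite exprMn mulrCA [enorm _ ^+ _]exprM enorm_sqr.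
  have -> : \sum_l (x - y) 0 l ^+ 2 = \sum_l (x 0 l - y 0 l) ^+ 2.
    by apply: eq_bigr => l _; rewrite !mxE.
  rewrite (@wronskian_coef_expand R d k i a x y); last by rewrite -ltnS.
  rewrite mulr_sumr; apply: eq_bigr => al _; rewrite mulr_sumr; apply: eq_bigr => be /eqP ->.
  ring.
rewrite exchange_big; apply: eq_bigr => al _ /=.
rewrite (exchange_big_dep (fun be : {ffun 'I_d -> 'I_(2 * k).+1} =>
   (mdegree (unbox al) + mdegree (unbox be) <= 2 * k)%N)) /=; last first.
  by move=> i be _ /eqP ->; rewrite leq_mul2l -ltnS ltn_ord.
apply: eq_bigr => be hbe; apply: sum_half_index => // ho.
by rewrite wronskian_coef_odd// !mul0r.
Unshelve. all: by end_near. Qed.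

(** * Finite combinations of evaluations dual to the monomials *)

Lemma univariate_dual (R : realType) (B : nat) : exists w : 'I_B -> 'I_B -> R,
  forall a b : 'I_B, \sum_i w a i * (i.+1)%:R ^+ b = (a == b)%:R.
Proof.
pose M : 'M[R]_B := (Vandermonde B (\row_i (i.+1)%:R))^T.
have Mu : M \in unitmx.
  rewrite unitmxE det_tr det_Vandermonde unitfE; apply/prodf_neq0 => i _.
  apply/prodf_neq0 => j ij; rewrite !mxE subr_eq0 eqr_nat eqSS.
  by rewrite gt_eqF.
exists (fun a i => invmx M a i) => a b.
have := congr1 (fun A : 'M[R]_B => A a b) (mulVmx Mu).
by rewrite !mxE => <-; apply: eq_bigr => i _; rewrite !mxE.
Qed.

(** On a grid, tensor products of functionals dual to the powers of one variable are
    dual to the monomials.  The coordinates are kept at least 1 so that all points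
    are nonzero, and bounded so that two rescaled copies of the grid become disjoint
    when their scales are far apart. *)
Lemma dual_functionals (R : realType) (d B : nat) :
  exists (I : finType) (z : I -> 'rV[R]_d) (lam : {ffun 'I_d -> nat} -> I -> R),
  [/\ injective z, forall i l, 1 <= z i 0 l <= (B.+1)%:R &
      forall al be, (mdegree al <= B)%N -> (mdegree be <= B)%N ->
        \sum_i lam al i * monomial (z i) be = (al == be)%:R].
Proof.
have [w hw] := univariate_dual R B.+1.
exists {ffun 'I_d -> 'I_B.+1}, (fun th : {ffun 'I_d -> 'I_B.+1} => \row_l ((th l).+1)%:R),
  (fun al (th : {ffun 'I_d -> 'I_B.+1}) => \prod_l w (box B al l) (th l)); split.
- move=> th th' e; apply/ffunP => l; apply: val_inj.
  have /eqP := congr1 (fun v : 'rV_d => v 0 l) e.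
  by rewrite !mxE eqr_nat eqSS => /eqP.
- by move=> th l; rewrite mxE ler1n ler_nat /=.
move=> al be hal hbe.
transitivity (\prod_l \sum_(i < B.+1) w (box B al l) i * (i.+1)%:R ^+ (box B be l)).
  rewrite bigA_distr_bigA; apply: eq_bigr => th _.
  rewrite /monomial -big_split; apply: eq_bigr => l _ /=.
  rewrite mxE [box B be l]ffunE inordK// ltnS.
  exact: leq_trans (entry_le_mdegree _ _) hbe.
under eq_bigr do rewrite hw.
have <- : (box B al == box B be) = (al == be).
  by apply/eqP/eqP => [e|->//]; rewrite -(boxK hal) e boxK.
case: eqP => [->|ne]; first by rewrite big1// => l _; rewrite eqxx.
have [l hl] : exists l, box B al l != box B be l.
  apply/existsP; rewrite -negb_forall; apply/negP => /forallP h.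
  by apply: ne; apply/ffunP => l; apply/eqP.
by rewrite (bigD1 l)//= (negPf hl) mul0r.
Qed.

Lemma pd_kernel_sum_ge0 (R : realType) d (kappa : 'rV[R]_d -> 'rV[R]_d -> R)
    (I : finType) (z : I -> 'rV[R]_d) (c : I -> R) :
  pd_kernel kappa -> injective z ->
  0 <= \sum_i \sum_j c i * c j * kappa (z i) (z j).
Proof.
move=> hpd zi.
have [|_ h] := hpd #|I| (z \o enum_val); first exact: inj_comp zi enum_val_inj.
pose v : 'rV[R]_#|I| := \row_i c (enum_val i).
have : 0 <= (v *m kernel_mx kappa (z \o enum_val) *m v^T) 0 0.
  have [v0|v0] := eqVneq v 0; first by rewrite v0 !mul0mx mxE.
  exact/ltW/h.
congr (0 <= _); rewrite mxE.
rewrite (reindex (@enum_val I predT)) /=; last first.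
  by exists enum_rank => j _; rewrite ?enum_valK ?enum_rankK.
under eq_bigr => j _ do rewrite !mxE mulr_suml /=.
rewrite exchange_big; apply: eq_bigr => i _ /=.
rewrite [RHS](reindex (@enum_val I predT)) /=; last first.
  by exists enum_rank => j _; rewrite ?enum_valK ?enum_rankK.
by apply: eq_bigr => j _; rewrite !mxE /=; ring.
Qed.

(** Positivity on the union of two point sets is what Cauchy-Schwarz between a
    functional on the one and a functional on the other amounts to. *)
Lemma pd_kernel_cross_ge0 (R : realType) d (kappa : 'rV[R]_d -> 'rV[R]_d -> R)
    (I : finType) (x y : I -> 'rV[R]_d) (b c : I -> R) :
  pd_kernel kappa -> injective x -> injective y -> (forall i j, x i <> y j) ->
  (forall u v, kappa u v = kappa v u) ->
  0 <= \sum_i \sum_j b i * b j * kappa (x i) (x j)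
     + 2 * (\sum_i \sum_j b i * c j * kappa (y j) (x i))
     + \sum_i \sum_j c i * c j * kappa (y i) (y j).
Proof.
move=> hpd xi yi xy ksym.
pose zz (i : I + I) := match i with inl i => x i | inr j => y j end.
pose cc (i : I + I) := match i with inl i => b i | inr j => c j end.
have zzi : injective zz.
  move=> [i|i] [j|j] /= e.
  - by rewrite (xi _ _ e).
  - by case: (xy _ _ e).
  - by case: (xy _ _ (esym e)).
  - by rewrite (yi _ _ e).
have := pd_kernel_sum_ge0 cc hpd zzi; congr (0 <= _).
rewrite big_sumType /=.
under eq_bigr => i _ do rewrite big_sumType /=.
under [X in _ + X = _]eq_bigr => i _ do rewrite big_sumType /=.
rewrite !big_split /= mulr_natl mulr2n.
have -> : \sum_i \sum_j c i * b j * kappa (y i) (x j) =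
   \sum_i \sum_j b i * c j * kappa (y j) (x i).
  by rewrite exchange_big; apply: eq_bigr => i _; apply: eq_bigr => j _; rewrite [c _ * _]mulrC.
have -> : \sum_i \sum_j b i * c j * kappa (x i) (y j) =
   \sum_i \sum_j b i * c j * kappa (y j) (x i).
  by apply: eq_bigr => i _; apply: eq_bigr => j _; rewrite ksym.
by rewrite !addrA.
Qed.

(** At h z_i, the monomial of index [al j] is h^|al j| times its value at z_i.  The
    weights compensate for this factor, so that for an injective [al] the functional
    supported by the points h z_i sends that monomial to [w j] at every scale h. *)
Definition scaled_weights (R : realType) (d M : nat) (I : finType)
    (lam : {ffun 'I_d -> nat} -> I -> R) (al : 'I_M -> {ffun 'I_d -> nat})
    (w : 'I_M -> R) (h : R) (i : I) : R :=
  \sum_j w j / h ^+ mdegree (al j) * lam (al j) i.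

Lemma pick_boxed_pair (R : realType) (d B : nat)
    (G : {ffun 'I_d -> nat} -> {ffun 'I_d -> nat} -> R) (p q : {ffun 'I_d -> nat}) :
  (mdegree p + mdegree q <= B)%N ->
  \sum_(al : {ffun 'I_d -> 'I_B.+1}) \sum_(be : {ffun 'I_d -> 'I_B.+1} |
     (mdegree (unbox al) + mdegree (unbox be) <= B)%N)
    G (unbox al) (unbox be) * ((p == unbox al)%:R * (q == unbox be)%:R) = G p q.
Proof.
move=> pq.
have pB : (mdegree p <= B)%N by lia.
have qB : (mdegree q <= B)%N by lia.
rewrite (bigD1 (box B p))//= (bigD1 (box B q))/= ?boxK// !eqxx !mulr1.
rewrite [X in _ + X + _]big1 ?addr0; last first.
  move=> be /andP[_ ne]; case: eqP => [e|_]; last by rewrite !mulr0.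
  by move: ne; rewrite e unboxK eqxx.
rewrite big1 ?addr0// => al ne; rewrite big1// => be _.
case: eqP => [e|_]; last by rewrite mul0r mulr0.
by move: ne; rewrite e unboxK eqxx.
Qed.

Lemma scaled_weights_order (R : realType) (d M n : nat) (I : finType)
    (lam : {ffun 'I_d -> nat} -> I -> R) (al : 'I_M -> {ffun 'I_d -> nat})
    (w : 'I_M -> R) (i : I) :
  (forall j, w j != 0 -> (mdegree (al j) <= n)%N) ->
  order_at0 0 (fun h => h ^+ n * scaled_weights lam al w h i).
Proof.
move=> hw.
have ho : order_at0 0 (fun h => \sum_j (w j * lam (al j) i) * h ^+ (n - mdegree (al j))).
  apply: order_at0_sum => j _; apply: order_at0Z.
  exact: (order_at0W (leq0n _) (order_at0X R _)).
apply: (order_at0_near _ ho); near=> h.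
have h0 : h != 0 by rewrite gt_eqF//; near: h; exact: nbhs_right_gt.
rewrite mulr_sumr; apply: eq_bigr => j _.
have [->|wj] := eqVneq (w j) 0; first by rewrite !mul0r mulr0.
by rewrite -{2}(subnK (hw j wj)) exprD; field; rewrite expf_neq0.
Unshelve. all: by end_near. Qed.

(** Duality makes the Taylor part of the kernel contribute the quadratic form of the
    Wronskian exactly.  The weights are O(h^(-k)), so the remainder O(h^(2k+1))
    contributes O(h). *)
Lemma scaled_gram_order (R : realType) (d k M : nat) (f : R -> R) (a : nat -> R)
    (r : option nat) (I : finType) (z : I -> 'rV[R]_d)
    (lam : {ffun 'I_d -> nat} -> I -> R) (al : 'I_M -> {ffun 'I_d -> nat})
    (w : 'I_M -> R) :
  analytic_at0 f a -> smoothness_order a r -> le_order_pred k r ->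
  (forall al be, (mdegree al <= 2 * k)%N -> (mdegree be <= 2 * k)%N ->
     \sum_i lam al i * monomial (z i) be = (al == be)%:R) ->
  (forall j, (mdegree (al j) <= k)%N) ->
  order_at0 1 (fun h => \sum_i \sum_j scaled_weights lam al w h i *
      scaled_weights lam al w h j * f (h * enorm (z i - z j)) -
    \sum_i \sum_j w i * w j * wronskian_coef a (al i) (al j)).
Proof.
move=> hf hr hk hdual hal.
pose B := (2 * k)%N.
pose T h i j := \sum_(ga : {ffun 'I_d -> 'I_B.+1})
     \sum_(be : {ffun 'I_d -> 'I_B.+1} |
       (mdegree (unbox ga) + mdegree (unbox be) <= 2 * k)%N)
    wronskian_coef a (unbox ga) (unbox be) *
      h ^+ (mdegree (unbox ga) + mdegree (unbox be)) *
      monomial (z i) (unbox ga) * monomial (z j) (unbox be).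
have ho : order_at0 1 (fun h => \sum_i \sum_j
    ((h ^+ k * scaled_weights lam al w h i) * (h ^+ k * scaled_weights lam al w h j)) *
      ((f (h * enorm (z i - z j)) - T h i j) / h ^+ B)).
  apply: order_at0_sum => i _; apply: order_at0_sum => j _.
  apply: (@order_at0M _ 0 1).
    by apply: (@order_at0M _ 0 0); apply: scaled_weights_order.
  by apply: order_at0_divX; rewrite addn1; exact: kernel_taylor hf hr hk.
apply: (order_at0_near _ ho); near=> h.
have h0 : h != 0 by rewrite gt_eqF//; near: h; exact: nbhs_right_gt.
have -> : \sum_i \sum_j w i * w j * wronskian_coef a (al i) (al j) =
   \sum_i \sum_j scaled_weights lam al w h i * scaled_weights lam al w h j * T h i j.
  pose S be := \sum_i scaled_weights lam al w h i * monomial (z i) be.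
  have hS be : (mdegree be <= B)%N -> S be =
      \sum_j w j / h ^+ mdegree (al j) * (al j == be)%:R.
    move=> hbe; rewrite /S; under eq_bigr do rewrite mulr_suml.
    rewrite exchange_big; apply: eq_bigr => j _ /=.
    rewrite -hdual//; last by apply: (leq_trans (hal j)); rewrite leq_pmull.
    by rewrite mulr_sumr; apply: eq_bigr => i _; rewrite mulrA.
  transitivity (\sum_(ga : {ffun 'I_d -> 'I_B.+1})
     \sum_(be : {ffun 'I_d -> 'I_B.+1} |
       (mdegree (unbox ga) + mdegree (unbox be) <= 2 * k)%N)
    wronskian_coef a (unbox ga) (unbox be) *
      h ^+ (mdegree (unbox ga) + mdegree (unbox be)) *
      (S (unbox ga) * S (unbox be))); last first.
    under [RHS]eq_bigr => i _ do under eq_bigr => j _ do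
      (rewrite mulr_sumr; under eq_bigr => ga _ do rewrite mulr_sumr).
    under [RHS]eq_bigr => i _ do rewrite exchange_big.
    rewrite [RHS]exchange_big; apply: eq_bigr => ga _ /=.
    under [RHS]eq_bigr => i _ do rewrite exchange_big.
    rewrite [RHS]exchange_big; apply: eq_bigr => be _ /=.
    rewrite /S mulr_suml mulr_sumr; apply: eq_bigr => i _.
    by rewrite mulr_sumr mulr_sumr; apply: eq_bigr => j _; ring.
  transitivity (\sum_i \sum_j \sum_(ga : {ffun 'I_d -> 'I_B.+1})
     \sum_(be : {ffun 'I_d -> 'I_B.+1} |
       (mdegree (unbox ga) + mdegree (unbox be) <= 2 * k)%N)
     (wronskian_coef a (unbox ga) (unbox be) *
      h ^+ (mdegree (unbox ga) + mdegree (unbox be)) *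
      ((w i / h ^+ mdegree (al i)) * (w j / h ^+ mdegree (al j)))) *
      ((al i == unbox ga)%:R * (al j == unbox be)%:R)).
    apply: eq_bigr => i _; apply: eq_bigr => j _.
    rewrite (@pick_boxed_pair _ _ _ (fun ga be => wronskian_coef a ga be *
      h ^+ (mdegree ga + mdegree be) * ((w i / h ^+ mdegree (al i)) *
        (w j / h ^+ mdegree (al j))))); last first.
      by rewrite /B mulSn mul1n leq_add.
    by rewrite exprD; field; rewrite !expf_neq0.
  under eq_bigr => i _ do rewrite exchange_big.
  rewrite exchange_big; apply: eq_bigr => ga _ /=.
  under eq_bigr => i _ do rewrite exchange_big.
  rewrite exchange_big; apply: eq_bigr => be hbe /=.
  have ga2 : (mdegree (unbox ga) <= B)%N by apply: leq_trans hbe; rewrite leq_addr.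
  have be2 : (mdegree (unbox be) <= B)%N by apply: leq_trans hbe; rewrite leq_addl.
  rewrite (hS _ ga2) (hS _ be2).
  rewrite mulr_suml mulr_sumr; apply: eq_bigr => i _.
  by rewrite mulr_sumr mulr_sumr; apply: eq_bigr => j _; ring.
rewrite -sumrB; apply: eq_bigr => i _; rewrite -sumrB; apply: eq_bigr => j _.
have -> : h ^+ B = h ^+ k * h ^+ k by rewrite -exprD /B mul2n addnn.
by field; rewrite expf_neq0.
Unshelve. all: by end_near. Qed.

Lemma wronskian_quad_ge0 (R : realType) (d k M : nat)
    (kappa : 'rV[R]_d -> 'rV[R]_d -> R) (f : R -> R) (a : nat -> R) (r : option nat)
    (al : 'I_M -> {ffun 'I_d -> nat}) (w : 'I_M -> R) :
  pd_kernel kappa -> stationary kappa f ->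
  analytic_at0 f a -> smoothness_order a r -> le_order_pred k r ->
  (forall j, (mdegree (al j) <= k)%N) ->
  0 <= \sum_i \sum_j w i * w j * wronskian_coef a (al i) (al j).
Proof.
move=> hpd hst hf hr hk hal.
have [I [z [lam [zi _ hdual]]]] := dual_functionals R d (2 * k).
apply: (order_at0_cvg_ge0 (scaled_gram_order w hf hr hk hdual hal)).
near=> h; have h0 : 0 < h by near: h; exact: nbhs_right_gt.
have hz : injective (fun i => h *: z i).
  by move=> i j /(scalerI (lt0r_neq0 h0))/zi.
have := pd_kernel_sum_ge0 (fun i => scaled_weights lam al w h i) hpd hz.
congr (0 <= _); apply: eq_bigr => i _; apply: eq_bigr => j _.
by rewrite hst -scalerBr enormZ// ltW.
Unshelve. all: by end_near. Qed.

(** * The first odd coefficient and the two-scale argument *)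

Definition dotp (R : realType) (d : nat) (x y : 'rV[R]_d) : R := \sum_l x 0 l * y 0 l.

Definition normsq (R : realType) (d : nat) (x : 'rV[R]_d) : R := \sum_l x 0 l ^+ 2.

Lemma dotp_expand (R : realType) (d B j : nat) (x y : 'rV[R]_d) : (j < B)%N ->
  dotp x y ^+ j = \sum_(ga : {ffun 'I_d -> 'I_B} | mdegree (unbox ga) == j)
    (j`!)%:R / (\prod_l (ga l)`!)%:R * (monomial x (unbox ga) * monomial y (unbox ga)).
Proof.
move=> jB; rewrite /dotp (multinomial _ jB); apply: eq_bigr => ga _; congr (_ * _).
rewrite /monomial -big_split/=; apply: eq_bigr => l _.
by rewrite exprMn ffunE.
Qed.

(** The powers of the scalar product are positive semidefinite kernels: the
    multinomial theorem writes them as sums of squares of monomial functionals. *)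
Lemma dotp_pow_gram (R : realType) (d a : nat) (I : finType) (z : I -> 'rV[R]_d)
    (g : I -> R) :
  \sum_i \sum_j g i * g j * dotp (z i) (z j) ^+ a =
  \sum_(ga : {ffun 'I_d -> 'I_a.+1} | mdegree (unbox ga) == a)
    (a`!)%:R / (\prod_l (ga l)`!)%:R * (\sum_i g i * monomial (z i) (unbox ga)) ^+ 2.
Proof.
under eq_bigr => i _ do under eq_bigr => j _ do
  rewrite (dotp_expand _ _ (ltnSn a)) mulr_sumr.
under eq_bigr => i _ do rewrite exchange_big.
rewrite exchange_big; apply: eq_bigr => ga _ /=.
rewrite expr2 mulr_suml mulr_sumr; apply: eq_bigr => i _.
by rewrite mulr_sumr mulr_sumr; apply: eq_bigr => j _; ring.
Qed.

Lemma multinomial_coef_gt0 (R : realType) (d a : nat) (ga : {ffun 'I_d -> 'I_a.+1}) :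
  0 < (a`!)%:R / (\prod_l (ga l)`!)%:R :> R.
Proof.
rewrite divr_gt0 ?ltr0n ?fact_gt0// prodn_gt0// => l; exact: fact_gt0.
Qed.

(** In z, the function (e . z)^a |z|^(2b) is homogeneous of degree a + 2b, so a
    functional dual to a monomial of another degree annihilates it. *)
Lemma dual_dotp_normsq (R : realType) (d B : nat) (I : finType) (z : I -> 'rV[R]_d)
    (lam : {ffun 'I_d -> nat} -> I -> R) (al : {ffun 'I_d -> nat}) (e : 'rV[R]_d) a b :
  (forall al be, (mdegree al <= B)%N -> (mdegree be <= B)%N ->
     \sum_i lam al i * monomial (z i) be = (al == be)%:R) ->
  (mdegree al <= B)%N -> (a + 2 * b <= B)%N -> (a + 2 * b)%N != mdegree al ->
  \sum_i lam al i * (dotp e (z i) ^+ a * normsq (z i) ^+ b) = 0.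
Proof.
move=> hdual hal hab ne.
have aB : (a < B.+1)%N by lia.
have bB : (b < B.+1)%N by lia.
under eq_bigr => i _.
  rewrite (dotp_expand _ _ aB) /normsq (multinomial _ bB) mulr_suml mulr_sumr.
  under eq_bigr => ga _ do rewrite mulr_sumr mulr_sumr.
  over.
rewrite exchange_big big1// => ga /eqP hga /=.
rewrite exchange_big big1// => de /eqP hde /=.
(* z^ga and (z_1^2, ..., z_d^2)^de multiply to the monomial of index ga + 2 de *)
pose be : {ffun 'I_d -> nat} := [ffun l => (unbox ga l + 2 * unbox de l)%N].
have hbe : mdegree be = (a + 2 * b)%N.
  rewrite -hga -hde /mdegree big_distrr -big_split/=.
  by apply: eq_bigr => l _; rewrite ffunE.
transitivity (\sum_i (a`!%:R / (\prod_l (ga l)`!)%:R * monomial e (unbox ga) *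
    (b`!%:R / (\prod_l (de l)`!)%:R)) * (lam al i * monomial (z i) be)).
  apply: eq_bigr => i _.
  have -> : monomial (z i) be = monomial (z i) (unbox ga) *
      \prod_l (z i 0 l ^+ 2) ^+ de l.
    rewrite /monomial -big_split/=; apply: eq_bigr => l _.
    by rewrite !ffunE exprD exprM.
  ring.
rewrite -mulr_sumr hdual// ?hbe//.
case: eqP => [e1|_]; last by rewrite mulr0.
by move: ne; rewrite -hbe e1 eqxx.
Qed.

(** From |e - u z|^2 = |e|^2 + u (-2 e.z + u |z|^2), this is |e|^J times the binomial
    expansion of order K of (1 + w)^(J/2), with w the relative increment. *)
Definition cross_poly (R : realType) (d K J : nat) (e z : 'rV[R]_d) (u : R) : R :=
  \sum_(n < K.+1) gbinom (J%:R / 2) n * (normsq e `^ (J%:R / 2) / normsq e ^+ n) *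
     (u * (-2 * dotp e z + u * normsq z)) ^+ n.

Lemma enormB_sqr (R : realType) (d : nat) (e z : 'rV[R]_d) (u : R) :
  enorm (e - u *: z) ^+ 2 = normsq e + u * (-2 * dotp e z + u * normsq z).
Proof.
rewrite enorm_sqr /normsq /dotp !mulr_sumr -big_split mulr_sumr -big_split/=.
by apply: eq_bigr => l _; rewrite !mxE; ring.
Qed.

Lemma enorm_pow (R : realType) (d : nat) (v : 'rV[R]_d) J :
  enorm v ^+ J = (enorm v ^+ 2) `^ (J%:R / 2).
Proof.
rewrite -[enorm v ^+ 2]powR_mulrn ?enorm_ge0// -powRrM mulrCA divff ?mulr1//.
by rewrite powR_mulrn ?enorm_ge0.
Qed.

Lemma cross_poly_order (R : realType) (d K J : nat) (e z : 'rV[R]_d) :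
  0 < normsq e ->
  order_at0 K.+1 (fun u => enorm (e - u *: z) ^+ J - cross_poly K J e z u).
Proof.
move=> q0; have [C C0 hC] := powR_taylor (J%:R / 2 : R) K.+1.
pose w u : R := u * (-2 * dotp e z + u * normsq z) / normsq e.
have wo : order_at0 1 w.
  have h1 : order_at0 0 (fun u : R => -2 * dotp e z + u * normsq z).
    apply: order_at0D; first exact: order_at0_cst.
    apply: (order_at0W (leq0n 1)); apply: (order_at0_near _ (order_at0Z (normsq z) (order_at0X R 1))).
    by near=> t; rewrite expr1 mulrC.
  have h2 := order_at0M (order_at0X R 1) h1.
  apply: (order_at0_near _ (order_at0Z (normsq e)^-1 h2)).
  by near=> t; rewrite expr1 /w mulrC.
have wsmall : \forall u \near 0^'+, `|w u| <= 2^-1.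
  have [C' hC'0 hC'] := order_at0_ge0 wo.
  near=> u; have u0 : 0 < u by near: u; exact: nbhs_right_gt.
  apply: (@le_trans _ _ (C' * u ^+ 1)); first by near: u.
  apply: (@le_trans _ _ ((C' + 1) * u)).
    by rewrite expr1 ler_wpM2r ?lerDl// ltW.
  rewrite mulrC -ler_pdivlMr ?ltr_wpDl//; apply/ltW; near: u.
  by apply: nbhs_right_lt; rewrite divr_gt0// ltr_wpDl.
have ho : order_at0 K.+1 (fun u => (normsq e `^ (J%:R / 2) * C) * w u ^+ K.+1).
  by apply: order_at0Z; have := order_at0_pow K.+1 wo; rewrite muln1.
apply: order_at0_le ho; near=> u.
have hw : `|w u| <= 2^-1 by near: u.
have -> : enorm (e - u *: z) ^+ J = normsq e `^ (J%:R / 2) * (1 + w u) `^ (J%:R / 2).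
  rewrite enorm_pow enormB_sqr -powRM ?ltW//.
    congr (_ `^ _); rewrite /w; field; exact: lt0r_neq0.
  by move: hw; rewrite ler_norml => /andP[]; lra.
have -> : cross_poly K J e z u =
    normsq e `^ (J%:R / 2) * \sum_(i < K.+1) gbinom (J%:R / 2) i * w u ^+ i.
  rewrite mulr_sumr; apply: eq_bigr => i _; rewrite /w [in RHS]expr_div_n; ring.
rewrite -mulrBr !normrM -mulrA ler_wpM2l// (ger0_norm C0) normrX.
exact: hC.
Unshelve. all: by end_near. Qed.

(** The coefficient of u^N obtained by applying the functional with weights [g] to
    the Gegenbauer-type expansion [cross_poly]. *)
Definition cross_coef (R : realType) (d K J : nat) (I : finType) (z : I -> 'rV[R]_d)
    (g : I -> R) (N : nat) (e : 'rV[R]_d) : R :=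
  \sum_(n < K.+1) \sum_(b < n.+1 | (n + b)%N == N)
    gbinom (J%:R / 2) n * (normsq e `^ (J%:R / 2) / normsq e ^+ n) *
    ((-2) ^+ (n - b) * 'C(n, b)%:R) *
    \sum_i g i * (dotp e (z i) ^+ (n - b) * normsq (z i) ^+ b).

Lemma dual_cross_poly (R : realType) (d B K J : nat) (I : finType) (z : I -> 'rV[R]_d)
    (lam : {ffun 'I_d -> nat} -> I -> R) (al : {ffun 'I_d -> nat}) (e : 'rV[R]_d) (u : R) :
  (forall al be, (mdegree al <= B)%N -> (mdegree be <= B)%N ->
     \sum_i lam al i * monomial (z i) be = (al == be)%:R) ->
  (mdegree al <= B)%N -> (2 * K <= B)%N ->
  \sum_i lam al i * cross_poly K J e (z i) u =
    u ^+ mdegree al * cross_coef K J z (lam al) (mdegree al) e.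
Proof.
move=> hdual hal hK; rewrite /cross_coef.
under eq_bigr => i _ do rewrite mulr_sumr.
rewrite exchange_big mulr_sumr; apply: eq_bigr => n _ /=.
set c := gbinom _ _ * _.
under eq_bigr => i _.
  rewrite exprMn exprDn mulr_sumr mulr_sumr mulr_sumr.
  over.
rewrite exchange_big /= mulr_sumr [RHS]big_mkcond; apply: eq_bigr => b _.
have bn : (b <= n)%N by rewrite -ltnS.
have nK : (n <= K)%N by rewrite -ltnS.
have e1 : (n - b + 2 * b = n + b)%N by lia.
transitivity (c * ((-2) ^+ (n - b) * 'C(n, b)%:R) * u ^+ (n + b) *
   \sum_i lam al i * (dotp e (z i) ^+ (n - b) * normsq (z i) ^+ b)).
  rewrite mulr_sumr; apply: eq_bigr => i _.
  rewrite exprD [(-2 * _) ^+ _]exprMn [(u * normsq _) ^+ _]exprMn -mulr_natr.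
  ring.
case: eqP => [<-|/eqP ne]; first by ring.
by rewrite (dual_dotp_normsq _ hdual)// ?mulr0// e1//; lia.
Qed.

(** The weights in e carry the factor |e|^(2K-J), which turns the powers of |e| into
    |e|^(2b) and makes the pairing symmetric in e and z.  Each b then gives a sum of
    squares by [dotp_pow_gram].  Its coefficient has the sign of (-2)^(n-b), which is
    (-1)^K since n + b = K, because the binomial coefficients are positive for
    2K <= J.  The term b = 0 is positive when [g] does not annihilate all monomials
    of degree K. *)
Lemma cross_gram_gt0 (R : realType) (d K J : nat) (I : finType) (z : I -> 'rV[R]_d)
    (g : I -> R) (be : {ffun 'I_d -> nat}) :
  (2 * K <= J)%N -> (forall i, 0 < normsq (z i)) -> mdegree be = K ->
  \sum_i g i * monomial (z i) be != 0 ->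
  0 < (-1) ^+ K * \sum_j g j * (normsq (z j) ^+ K / normsq (z j) `^ (J%:R / 2)) *
    cross_coef K J z g K (z j).
Proof.
move=> KJ q0 hbe hg.
pose c (n b : nat) : R := gbinom (J%:R / 2) n * (2 ^+ (n - b) * 'C(n, b)%:R).
have c0 (n b : nat) : (n <= K)%N -> (b <= n)%N -> 0 < c n b.
  move=> nK bn; apply: mulr_gt0; last by rewrite mulr_gt0 ?exprn_gt0 ?ltr0n ?bin_gt0.
  apply: gbinom_gt0; have : (n%:R : R) * 2 <= J%:R by rewrite -natrM ler_nat; lia.
  lra.
pose G (n b : nat) : R := \sum_j \sum_i (g j * normsq (z j) ^+ b) * (g i * normsq (z i) ^+ b)
   * dotp (z j) (z i) ^+ (n - b).
have G0 n b : 0 <= G n b.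
  rewrite /G dotp_pow_gram sumr_ge0// => ga _.
  by rewrite mulr_ge0 ?sqr_ge0// ltW// multinomial_coef_gt0.
have GK : 0 < G K 0%N.
  rewrite /G subn0 dotp_pow_gram (bigD1 (box K be))/=; last by rewrite boxK ?hbe.
  apply: ltr_pwDl; last first.
    apply: sumr_ge0 => ga _.
    by rewrite mulr_ge0 ?sqr_ge0// ltW// multinomial_coef_gt0.
  rewrite mulr_gt0 ?multinomial_coef_gt0// lt_def sqr_ge0 andbT sqrf_eq0 boxK ?hbe//.
  by under eq_bigr do rewrite expr0 mulr1.
rewrite [ltRHS](_ : _ = \sum_(n < K.+1) \sum_(b < n.+1 | (n + b)%N == K) c n b * G n b).
  rewrite (bigD1 ord_max)//= (bigD1 ord0)/= ?addn0//.
  rewrite -addrA; apply: ltr_pwDl; first by rewrite mulr_gt0 ?c0.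
  apply: addr_ge0.
    by apply: sumr_ge0 => b _; rewrite mulr_ge0// ltW// c0// -ltnS.
  apply: sumr_ge0 => n _; apply: sumr_ge0 => b _; rewrite mulr_ge0// ltW// c0// -ltnS//.
rewrite mulr_sumr /cross_coef; under eq_bigr => j _.
  rewrite mulr_sumr mulr_sumr; under eq_bigr => n _ do rewrite mulr_sumr mulr_sumr.
  over.
rewrite exchange_big; apply: eq_bigr => n _ /=.
rewrite exchange_big; apply: eq_bigr => b /eqP nb /=.
have bn : (b <= n)%N by rewrite -ltnS.
rewrite /G mulr_sumr; apply: eq_bigr => j _.
rewrite !mulr_sumr; apply: eq_bigr => i _.
have qn : normsq (z j) != 0 by rewrite gt_eqF.
have qp : normsq (z j) `^ (J%:R / 2) != 0 by rewrite gt_eqF ?powR_gt0.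
have -> : (-1) ^+ K = (-1) ^+ (n - b) :> R.
  rewrite -signr_odd -[RHS]signr_odd; congr (_ ^+ nat_of_bool _).
  by rewrite -[in LHS]nb oddB// oddD.
have -> : (-2) ^+ (n - b) = (-1) ^+ (n - b) * 2 ^+ (n - b) :> R by rewrite -exprMn mulN1r.
have -> : normsq (z j) ^+ K = normsq (z j) ^+ n * normsq (z j) ^+ b by rewrite -exprD nb.
have s1 : (-1) ^+ (n - b) * (-1) ^+ (n - b) = 1 :> R by rewrite -exprMn mulrNN mulr1 expr1n.
rewrite /c; move: s1; set s := (-1) ^+ (n - b) => s1.
transitivity ((s * s) * (gbinom (J%:R / 2) n * (2 ^+ (n - b) * 'C(n, b)%:R) *
  ((g j * normsq (z j) ^+ b) * (g i * normsq (z i) ^+ b) * dotp (z j) (z i) ^+ (n - b)))).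
  field; by rewrite qp expf_neq0.
by rewrite s1 mul1r.
Qed.

(** With h = t^(2p) and u = h / t, the distance of the two rescaled points is
    t |z_j - u z_i|.  Expand f in powers of this distance, then each power in u.  The
    part of the functional dual to the monomial of index [al m] has weights of size
    h^(-|al m|) and keeps only the power u^|al m|, which leaves t^(-|al m|); the
    factor t^K makes a polynomial of the sum.  All the errors are multiplied by the
    size h^(-K) = t^(-2pK) of the weights. *)
Lemma cross_order (R : realType) (d k K M n p : nat) (f : R -> R) (a : nat -> R)
    (I : finType) (z : I -> 'rV[R]_d)
    (lam : {ffun 'I_d -> nat} -> I -> R) (al : 'I_M -> {ffun 'I_d -> nat})
    (w : 'I_M -> R) (mu : I -> R) :
  analytic_at0 f a ->
  (forall al be, (mdegree al <= 2 * k)%N -> (mdegree be <= 2 * k)%N ->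
     \sum_i lam al i * monomial (z i) be = (al == be)%:R) ->
  (forall i, 0 < normsq (z i)) ->
  (K <= k)%N -> (forall j, w j != 0 -> (mdegree (al j) <= K)%N) ->
  (0 < p)%N -> (n < 2 * p)%N ->
  order_at0 n (fun t =>
    t ^+ K * (\sum_i \sum_j scaled_weights lam al w (t ^+ (2 * p)) i * mu j *
       f (enorm (t *: z j - t ^+ (2 * p) *: z i)))
    - (\sum_(J < n + 2 * p * K) \sum_m (a J * w m *
         (\sum_j mu j * cross_coef K J z (lam (al m)) (mdegree (al m)) (z j)))
         *: 'X^(J + K - mdegree (al m)) : {poly R}).[t]).
Proof.
move=> hf hdual hq hKk hw hp hn.
set N := (n + 2 * p * K)%N.
pose u (t : R) := t ^+ (2 * p - 1).
have u1 : (0 < 2 * p - 1)%N by lia.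
pose rho i j t := enorm (z j - u t *: z i).
pose sw t i := t ^+ (2 * p * K) * scaled_weights lam al w (t ^+ (2 * p)) i.
have hsw i : order_at0 0 (fun t => sw t i).
  have := order_at0_comp (_ : (0 < 2 * p)%N) (scaled_weights_order lam i hw).
  rewrite muln0 => /(_ ltac:(lia)) h; apply: (order_at0_near _ h).
  by near=> t; rewrite /sw (exprM t (2 * p) K).
have hrho i j : \forall t \near 0^'+,
    0 <= rho i j t <= 1 + (normsq (z j) + (2 * `|dotp (z j) (z i)| + normsq (z i))).
  near=> t; have t0 : 0 < t by near: t; exact: nbhs_right_gt.
  have t1 : t < 1 by near: t; exact: nbhs_right_lt.
  rewrite enorm_ge0/=; have u0 : 0 <= u t <= 1.
    by rewrite /u exprn_ge0 ?exprn_ile1// ltW.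
  apply: (@le_trans _ _ (1 + rho i j t ^+ 2)).
    have := sqr_ge0 (rho i j t - 1); have := sqr_ge0 (rho i j t); rewrite sqrrB1; lra.
  rewrite lerD2l enormB_sqr lerD2l.
  have ni : 0 <= normsq (z i) by rewrite ltW.
  have nd : - dotp (z j) (z i) <= `|dotp (z j) (z i)|.
    by rewrite lerNl; have := ler_norm (- dotp (z j) (z i)); rewrite normrN; lra.
  move: u0 nd ni (normr_ge0 (dotp (z j) (z i))).
  move: (u t) (dotp _ _) (normsq (z i)) `|_| => v D q A /andP[v0 v1] nd q0' A0.
  have v1' : 0 <= 1 - v by rewrite subr_ge0.
  have nd' : 0 <= A + D by lra.
  have := mulr_ge0 v1' A0; have := mulr_ge0 v0 nd'.
  have := mulr_ge0 v1' q0'; have := mulr_ge0 v0 (mulr_ge0 v1' q0'); lra.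
(* the sums [o1] and [o2] are the errors of the expansions in the distance and in u;
   the division by t^(2pK) comes from the weights of l_h *)
have o1 i j : order_at0 n (fun t => (sw t i * mu j) * (t ^+ K *
     ((f (t * rho i j t) - \sum_(J < N) a J * (t * rho i j t) ^+ J) / t ^+ (2 * p * K)))).
  apply: (@order_at0M _ 0 n).
    by apply: (@order_at0M _ 0 0) => //; exact: order_at0_cst.
  apply: (@order_at0M _ 0 n); first exact: (order_at0W (leq0n _) (order_at0X R K)).
  apply: order_at0_divX; rewrite addnC; apply: analytic_order (hrho i j) => //.
have o2 i j (J : nat) : order_at0 n (fun t => (sw t i * mu j * a J) *
    ((t ^+ (J + K) * (rho i j t ^+ J - cross_poly K J (z j) (z i) (u t))) / t ^+ (2 * p * K))).
  apply: (@order_at0M _ 0 n).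
    by apply: (@order_at0M _ 0 0); [apply: (@order_at0M _ 0 0) => //|]; exact: order_at0_cst.
  apply: order_at0_divX.
  have h := order_at0M (order_at0X R (J + K)) (order_at0_comp u1 (cross_poly_order K J (z i) (hq j))).
  apply: order_at0W h; nia.
have ho : order_at0 n (fun t => \sum_i \sum_j ((sw t i * mu j) * (t ^+ K *
     ((f (t * rho i j t) - \sum_(J < N) a J * (t * rho i j t) ^+ J) / t ^+ (2 * p * K)))
   + \sum_(J < N) (sw t i * mu j * a J) *
    ((t ^+ (J + K) * (rho i j t ^+ J - cross_poly K J (z j) (z i) (u t))) / t ^+ (2 * p * K)))).
  apply: order_at0_sum => i _; apply: order_at0_sum => j _; apply: order_at0D => //.
  by apply: order_at0_sum => J _.
apply: (order_at0_near _ ho); near=> t.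
have t0 : 0 < t by near: t; exact: nbhs_right_gt.
have tn0 : t != 0 by rewrite gt_eqF.
pose sc i := scaled_weights lam al w (t ^+ (2 * p)) i.
have -> : (\sum_(J < N) \sum_m (a J * w m *
         (\sum_j mu j * cross_coef K J z (lam (al m)) (mdegree (al m)) (z j)))
         *: 'X^(J + K - mdegree (al m)) : {poly R}).[t] =
   \sum_i \sum_j \sum_(J < N) sc i * mu j * a J * t ^+ (J + K) *
       cross_poly K J (z j) (z i) (u t).
  rewrite horner_sum.
  under [RHS]eq_bigr => i _ do rewrite exchange_big.
  rewrite [RHS]exchange_big; apply: eq_bigr => J _ /=.
  rewrite [RHS]exchange_big horner_sum /=.
  transitivity (\sum_j \sum_m a J * w m * (mu j * cross_coef K J z (lam (al m)) (mdegree (al m)) (z j))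
      * t ^+ (J + K - mdegree (al m))).
    rewrite exchange_big; apply: eq_bigr => m _ /=.
    by rewrite !hornerE mulr_sumr mulr_suml.
  apply: eq_bigr => j _.
  transitivity (\sum_m mu j * a J * t ^+ (J + K) * (w m / t ^+ (2 * p) ^+ mdegree (al m)) *
      \sum_i lam (al m) i * cross_poly K J (z j) (z i) (u t)); last first.
    under [LHS]eq_bigr => m _ do rewrite mulr_sumr.
    rewrite [LHS]exchange_big; apply: eq_bigr => i _ /=.
    move: (cross_poly _ _ _ _ _) => cp; rewrite /sc /scaled_weights.
    rewrite !mulr_suml; apply: eq_bigr => m _; ring.
  apply: eq_bigr => m _.
  have [->|wm] := eqVneq (w m) 0; first by rewrite !(mul0r, mulr0).
  have hm := hw m wm.
  rewrite (dual_cross_poly _ _ _ hdual); [|lia|lia].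
  rewrite /u.
  have -> : t ^+ (2 * p) ^+ mdegree (al m) = t ^+ mdegree (al m) *
      t ^+ (2 * p - 1) ^+ mdegree (al m).
    by rewrite -exprMn -exprS; congr ((_ ^+ _) ^+ _); lia.
  have -> : t ^+ (J + K) = t ^+ (J + K - mdegree (al m)) * t ^+ mdegree (al m).
    by rewrite -exprD; congr (_ ^+ _); lia.
  field; by rewrite !expf_neq0.
rewrite mulr_sumr -sumrB; apply: eq_bigr => i _.
rewrite mulr_sumr -sumrB; apply: eq_bigr => j _.
have -> : enorm (t *: z j - t ^+ (2 * p) *: z i) = t * rho i j t.
  have e2p : (2 * p = (2 * p - 1).+1)%N by lia.
  by rewrite {1}e2p exprS -scalerA -scalerBr enormZ// ltW.
have swE : sw t i = t ^+ (2 * p * K) * sc i by [].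
rewrite swE; have tk : t ^+ (2 * p * K) != 0 by rewrite expf_neq0.
have -> : \sum_(J < N) t ^+ (2 * p * K) * sc i * mu j * a J *
    (t ^+ (J + K) * (rho i j t ^+ J - cross_poly K J (z j) (z i) (u t)) / t ^+ (2 * p * K)) =
  sc i * mu j * t ^+ K * (\sum_(J < N) a J * (t * rho i j t) ^+ J)
   - \sum_(J < N) sc i * mu j * a J * t ^+ (J + K) * cross_poly K J (z j) (z i) (u t).
  rewrite [X in _ = X - _]mulr_sumr -sumrB; apply: eq_bigr => J _.
  by rewrite exprMn exprD; field.
have key (T s0 m tK f0 S1 S2 : R) : T != 0 ->
    T * s0 * m * (tK * ((f0 - S1) / T)) + (s0 * m * tK * S1 - S2) = tK * (s0 * m * f0) - S2.
  by move=> ?; field.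
exact: key.
Unshelve. all: by end_near. Qed.

(** The weight vector has a single parity and K is its top degree.  The coefficient
    of t^(2s-1) in the expansion of [cross_order] comes from pairs (J, m) with
    J = 2s - 1 - (K - |al m|); such a J is odd and at most 2s - 1, so a_J is 0
    unless J = 2s - 1 and |al m| = K. *)
Lemma wronskian_quad_neq0 (R : realType) (d k M s : nat)
    (kappa : 'rV[R]_d -> 'rV[R]_d -> R) (f : R -> R) (a : nat -> R)
    (al : 'I_M -> {ffun 'I_d -> nat}) (w : 'I_M -> R) (j0 : 'I_M) :
  (0 < d)%N -> pd_kernel kappa -> stationary kappa f ->
  analytic_at0 f a -> smoothness_order a (Some s) -> (k <= s - 1)%N ->
  (forall j, (mdegree (al j) <= k)%N) -> injective al -> w j0 != 0 ->
  (forall j, w j != 0 -> (mdegree (al j) <= mdegree (al j0))%N /\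
     odd (mdegree (al j)) = odd (mdegree (al j0))) ->
  \sum_i \sum_j w i * w j * wronskian_coef a (al i) (al j) != 0.
Proof.
move=> d0 hpd hst hf hr hk hal alinj wj0 hw; apply/eqP => hquad.
have [s1 as0 hodd] := hr.
have [I [z [lam [zi zb hdual]]]] := dual_functionals R d (2 * k).
set K := mdegree (al j0) in hw *.
have Kk : (K <= k)%N by exact: hal.
pose l0 : 'I_d := Ordinal d0.
have zq i : 0 < normsq (z i).
  rewrite /normsq (bigD1 l0)//= ltr_pwDl//.
    by have /andP[h _] := zb i l0; rewrite exprn_gt0// (lt_le_trans _ h).
  by apply: sumr_ge0 => l _; rewrite sqr_ge0.
(* l_h lives at scale h = t^(2p); p = 2s is large enough for all the errors to be
   O(t^(2s)) *)
pose p := (2 * s)%N.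
pose J0 := (2 * s - 1)%N.
pose Lam j := \sum_(m | mdegree (al m) == K) w m * lam (al m) j.
pose mu j := Lam j * (normsq (z j) ^+ K / normsq (z j) `^ (J0%:R / 2)).
pose X t := \sum_i \sum_j scaled_weights lam al w (t ^+ (2 * p)) i * mu j *
       f (enorm (t *: z j - t ^+ (2 * p) *: z i)).
pose A t := \sum_i \sum_j scaled_weights lam al w (t ^+ (2 * p)) i *
   scaled_weights lam al w (t ^+ (2 * p)) j * f (t ^+ (2 * p) * enorm (z i - z j)).
pose C t := \sum_i \sum_j mu i * mu j * f (t * enorm (z i - z j)).
have hA : order_at0 (p + p) A.
  have p0 : (0 < 2 * p)%N by rewrite /p; lia.
  have := order_at0_comp p0 (scaled_gram_order w hf hr (hk : le_order_pred k (Some s)) hdual hal).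
  rewrite hquad muln1 addnn -mul2n; apply: order_at0_near.
  by near=> t; rewrite subr0.
have hC : order_at0 0 C.
  apply: order_at0_sum => i _; apply: order_at0_sum => j _; apply: order_at0Z.
  apply: (order_at0_near _ (@analytic_order _ _ _ 0 (fun=> enorm (z i - z j))
    (enorm (z i - z j)) hf _)); last by near=> t; rewrite enorm_ge0 lexx.
  by near=> t; rewrite big_ord0 subr0.
(* 0 <= A + 2 sg t^p X + t^(2p) C for both signs sg: as A is O(t^(2p)) and C is
   bounded, X is O(t^p) *)
have hX : order_at0 p X.
  have hB : order_at0 p (fun t => 2^-1 * (A t / t ^+ p + t ^+ p * C t)).
    apply: order_at0Z; apply: order_at0D; first exact: order_at0_divX.
    by have := order_at0M (order_at0X R p) hC; rewrite addn0.
  apply: order_at0_le hB; near=> t.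
  have t0 : 0 < t by near: t; exact: nbhs_right_gt.
  have tsmall : t < ((2 * k).+1)%:R^-1 by near: t; apply: nbhs_right_lt; rewrite invr_gt0.
  have tn0 : t != 0 by rewrite gt_eqF.
  (* the coordinates of z lie between 1 and 2k + 1 *)
  have hne i j : t ^+ (2 * p) *: z i <> t *: z j.
    move=> /(congr1 (fun v : 'rV_d => v 0 l0)); rewrite !mxE.
    have -> : t ^+ (2 * p) = t * t ^+ (2 * p - 1).
      by rewrite -exprS; congr (_ ^+ _); rewrite /p; lia.
    rewrite -mulrA => /(mulfI tn0) e.
    have /andP[h1 _] := zb j l0; have /andP[h2 h3] := zb i l0.
    have t1 : t <= 1 by apply: (le_trans (ltW tsmall)); rewrite invf_le1// ler1n.
    have tt : t ^+ (2 * p - 1) <= t.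
      have p1 : (1 <= 2 * p - 1)%N by rewrite /p; lia.
      by rewrite -[leRHS]expr1 ler_wiXn2l// ltW.
    have : t * (2 * k).+1%:R < 1 by rewrite -ltr_pdivlMr// mul1r.
    apply/negP; rewrite -leNgt; apply: (le_trans h1); rewrite -e ler_pM//.
      by rewrite exprn_ge0// ltW.
    exact: le_trans h2.
  have hcs (sg : R) : sg ^+ 2 = 1 ->
      0 <= A t + 2 * (sg * t ^+ p * X t) + t ^+ p * t ^+ p * C t.
    move=> sg1.
    have xi : injective (fun i => t ^+ (2 * p) *: z i).
      by move=> i j /(scalerI (lt0r_neq0 (exprn_gt0 _ t0)))/zi.
    have yi : injective (fun i => t *: z i) by move=> i j /(scalerI tn0)/zi.
    have ksym u v : kappa u v = kappa v u by rewrite !hst enormBC.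
    have := @pd_kernel_cross_ge0 R d kappa I _ _
      (scaled_weights lam al w (t ^+ (2 * p))) (fun j => sg * t ^+ p * mu j)
      hpd xi yi hne ksym.
    congr (0 <= _ + 2 * _ + _).
    - apply: eq_bigr => i _; apply: eq_bigr => j _.
      by rewrite hst -scalerBr enormZ// exprn_ge0// ltW.
    - rewrite mulr_sumr; apply: eq_bigr => i _; rewrite mulr_sumr; apply: eq_bigr => j _.
      by rewrite hst; ring.
    - rewrite mulr_sumr; apply: eq_bigr => i _; rewrite mulr_sumr; apply: eq_bigr => j _.
      rewrite hst -scalerBr enormZ ?ltW//.
      transitivity ((sg ^+ 2) * (t ^+ p * t ^+ p * (mu i * mu j * f (t * enorm (z i - z j))))).
        by ring.
      by rewrite sg1 mul1r.
  have c1 : 0 <= A t + 2 * (1 * t ^+ p * X t) + t ^+ p * t ^+ p * C t.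
    by apply: hcs; rewrite expr1n.
  have c2 : 0 <= A t + 2 * (-1 * t ^+ p * X t) + t ^+ p * t ^+ p * C t.
    by apply: hcs; rewrite sqrrN expr1n.
  have tp : 0 < t ^+ p by rewrite exprn_gt0.
  have -> : A t / t ^+ p + t ^+ p * C t = (A t + t ^+ p * t ^+ p * C t) / t ^+ p.
    by field; rewrite gt_eqF.
  have c3 : 0 <= A t + t ^+ p * t ^+ p * C t by lra.
  rewrite [leRHS]ger0_norm; last by rewrite mulr_ge0// divr_ge0// ltW.
  have e1 : `|X t| * t ^+ p = `|X t * t ^+ p| by rewrite normrM (gtr0_norm tp).
  rewrite mulrA ler_pdivlMr// e1 ler_norml.
  by apply/andP; split; lra.
have hn : (2 * s < 2 * p)%N by rewrite /p; lia.
have p0 : (0 < p)%N by rewrite /p; lia.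
have hw' j : w j != 0 -> (mdegree (al j) <= K)%N by move=> /hw[].
have hcross := cross_order mu hf hdual zq Kk hw' p0 hn.
set Q : {poly R} := (X in horner X) in hcross.
have hQ : order_at0 (2 * s) (fun t => Q.[t]).
  have h1 : order_at0 (2 * s) (fun t => t ^+ K * X t).
    by apply: (order_at0W (leq_addl K _)); apply: order_at0M => //; exact: order_at0X.
  apply: (order_at0_near _ (order_at0D h1 (order_at0N hcross))).
  by near=> t; rewrite opprB addrC subrK.
have := order_at0_poly hQ (_ : (J0 < 2 * s)%N); rewrite /J0 => /(_ ltac:(lia)).
rewrite -/J0 => hcoef.
pose G := \sum_j mu j * \sum_(m | mdegree (al m) == K) w m * cross_coef K J0 z (lam (al m)) (mdegree (al m)) (z j).
have hG : 0 < (-1) ^+ K * G.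
  have gne : \sum_i Lam i * monomial (z i) (al j0) != 0.
    rewrite /Lam; under eq_bigr do rewrite mulr_suml.
    rewrite exchange_big (bigD1 j0)//= [X in _ + X]big1 ?addr0.
      under eq_bigr do rewrite -mulrA.
      by rewrite -mulr_sumr hdual ?eqxx ?mulr1//; apply: (leq_trans (hal _)); rewrite leq_pmull.
    move=> m /andP[/eqP _ mj0]; under eq_bigr do rewrite -mulrA.
    rewrite -mulr_sumr hdual ?(inj_eq alinj) ?(negPf mj0) ?mulr0//;
      by apply: (leq_trans (hal _)); rewrite leq_pmull.
  have KJ : (2 * K <= J0)%N by rewrite /J0; lia.
  have := cross_gram_gt0 KJ zq (erefl K) gne; congr (0 < _ * _).
  apply: eq_bigr => j _; congr (_ * _); rewrite /cross_coef.
  under [RHS]eq_bigr => m /eqP -> do rewrite mulr_sumr.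
  rewrite exchange_big; apply: eq_bigr => n _ /=.
  under [RHS]eq_bigr do rewrite mulr_sumr.
  rewrite exchange_big; apply: eq_bigr => b _ /=.
  rewrite /Lam; under eq_bigr do rewrite mulr_suml.
  rewrite exchange_big mulr_sumr; apply: eq_bigr => m _ /=.
  by rewrite [RHS]mulrCA; congr (_ * _); rewrite mulr_sumr; apply: eq_bigr => i _; rewrite -mulrA.
suff e : Q`_J0 = a J0 * G.
  move/eqP: hcoef; rewrite e mulf_eq0 (negPf as0) /= => /eqP G0.
  by move: hG; rewrite G0 mulr0 ltxx.
have hJ0 : (J0 < 2 * s + 2 * p * K)%N by rewrite /J0; lia.
rewrite /Q coef_sum (bigD1 (Ordinal hJ0))//= [X in _ + X]big1 ?addr0; last first.
  move=> J /negP JJ0. rewrite coef_sum big1// => m _; rewrite coefZ coefXn.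
  have [->|wm] := eqVneq (w m) 0; first by rewrite mulr0 !mul0r.
  have [hm om] := hw m wm.
  case: eqP => [e|_]; last by rewrite mulr0.
  have JJ : (J < J0)%N.
    rewrite ltn_neqAle; apply/andP; split; last by lia.
    by apply/negP => /eqP e1; apply: JJ0; apply/eqP; apply: val_inj.
  have oJ : odd J.
    have : odd (J + K - mdegree (al m)) by rewrite -e /J0 oddB ?oddM//; lia.
    by rewrite -addnBA// oddD oddB// om addbb addbF.
  rewrite (_ : a J = 0) ?mul0r//.
  apply: (@smooth_odd_coef _ a (Some s) (s - 1)) => //=.
  by move: JJ; rewrite /J0; lia.
rewrite coef_sum /G.
under [X in _ = _ * X]eq_bigr do rewrite mulr_sumr.
rewrite [X in _ = _ * X]exchange_big [RHS]mulr_sumr [RHS]big_mkcond; apply: eq_bigr => m _ /=.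
rewrite coefZ coefXn; have [wm|wm] := eqVneq (w m) 0.
  rewrite wm mulr0 !mul0r; case: ifP => // _; rewrite big1 ?mulr0// => j _.
  by rewrite mul0r mulr0.
have [hm om] := hw m wm.
have -> : (J0 == J0 + K - mdegree (al m))%N = (mdegree (al m) == K).
  by rewrite -addnBA// -{1}[J0]addn0 eqn_add2l eq_sym subn_eq0 eqn_leq hm.
case: eqP => _; last by rewrite mulr0.
rewrite mulr1 -mulrA; congr (_ * _); rewrite mulr_sumr; apply: eq_bigr => j _.
by rewrite mulrCA.
Unshelve. all: by end_near. Qed.

(** * Smooth kernels on the line *)

Lemma bin_le_exp2 n m : ('C(n, m) <= 2 ^ n)%N.
Proof.
have [nm|mn] := ltnP n m; first by rewrite bin_small.
rewrite (expnDn 1 1) (bigD1 (inord m))//= inordK ?ltnS// !exp1n !muln1.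
exact: leq_addr.
Qed.

(** The square truncation p, q < N differs from the partial sum p + q < N of the power
    series by terms of total degree at least N, which are dominated by
    M 4^(-(p+q)) <= M 2^(-N) 2^(-p) 2^(-q) when |x| and |y| are at most rho / 8.
    Unlike the triangular truncation, the square one factors through a space of
    small dimension when the coefficients satisfy a recurrence. *)
Lemma square_truncation_cvg (R : realType) (f : R -> R) (a : nat -> R) (M rho x y : R) :
  0 < rho -> (forall n, `|a n| * rho ^+ n <= M) ->
  (forall t, `|t| < rho -> pseries a t @ \oo --> f t) ->
  (forall n, odd n -> a n = 0) ->
  `|x| <= rho / 8 -> `|y| <= rho / 8 ->
  (\sum_(p < N) \sum_(q < N)
     a (p + q)%N * ((-1) ^+ q * 'C((p + q)%N, p)%:R * x ^+ p * y ^+ q))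
    @[N --> \oo] --> f `|x - y|.
Proof.
move=> r0 hM hf hodd hx hy.
have M0 : 0 <= M by apply: le_trans (hM 0%N); rewrite mulr_ge0// exprn_ge0// ltW.
pose c p q : R := a (p + q)%N * ((-1) ^+ q * 'C((p + q)%N, p)%:R * x ^+ p * y ^+ q).
have hS N : pseries a `|x - y| N = \sum_(p < N) \sum_(q < N | (p + q < N)%N) c p q.
  rewrite /pseries /series /= big_mkord.
  transitivity (\sum_(n < N) \sum_(pq : 'I_N * 'I_N | (pq.1 + pq.2)%N == n) c pq.1 pq.2).
    apply: eq_bigr => n _.
    have -> : a n * `|x - y| ^+ n = a n * (x - y) ^+ n.
      case: (boolP (odd n)) => on; first by rewrite hodd// !mul0r.
      by rewrite -normrX ger0_norm// exprn_even_ge0.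
    rewrite -(@binom_pairs _ x y N n (ltn_ord n)) mulr_sumr.
    by apply: eq_bigr => pq /eqP e; rewrite /c e.
  rewrite [RHS]pair_big_dep /= (exchange_big_dep (fun pq : 'I_N * 'I_N => (pq.1 + pq.2 < N)%N)) /=.
    apply: eq_bigr => pq hpq; rewrite (big_pred1 (Ordinal hpq))// .
  by move=> i pq _ /eqP ->.
have bound N : `|(\sum_(p < N) \sum_(q < N) c p q) - pseries a `|x - y| N| <= 4 * M * (2^-1) ^+ N.
  rewrite hS -sumrB.
  (* binomials are at most 2^(p+q), hence the radius rho / 8 gives ratios 1/4 *)
  have cb p q : (N <= p + q)%N -> `|c p q| <= M * 2^-1 ^+ N * (2^-1 ^+ p * 2^-1 ^+ q).
    move=> Npq; rewrite /c !normrM !normrX normrN1 expr1n mul1r normr_nat.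
    have h1 : `|x| ^+ p <= (rho / 8) ^+ p by rewrite lerXn2r// nnegrE divr_ge0// ltW.
    have h2 : `|y| ^+ q <= (rho / 8) ^+ q by rewrite lerXn2r// nnegrE divr_ge0// ltW.
    have h3 : ('C(p + q, p))%:R <= 2 ^+ (p + q) :> R by rewrite -natrX ler_nat bin_le_exp2.
    have h4 : ('C(p + q, p))%:R * `|x| ^+ p * `|y| ^+ q <= (rho / 4) ^+ (p + q).
      apply: (@le_trans _ _ (2 ^+ (p + q) * (rho / 8) ^+ p * (rho / 8) ^+ q)).
        by rewrite !ler_pM// ?mulr_ge0// ?exprn_ge0.
      by rewrite -mulrA -exprD -exprMn (_ : 2 * (rho / 8) = rho / 4)//; field.
    apply: (@le_trans _ _ (`|a (p + q)%N| * (rho / 4) ^+ (p + q))); first by rewrite ler_wpM2l.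
    rewrite expr_div_n mulrA.
    apply: (@le_trans _ _ (M / 4 ^+ (p + q))); first by rewrite ler_wpM2r// invr_ge0 exprn_ge0.
    rewrite -mulrA ler_wpM2l// -exprD.
    have -> : (4 ^+ (p + q))^-1 = 2^-1 ^+ (p + q) * 2^-1 ^+ (p + q) :> R.
      by rewrite -exprMn -exprVn; congr (_ ^+ _); field.
    rewrite ler_wpM2r ?exprn_ge0//.
    by rewrite ler_wiXn2l// ?invr_ge0// invf_le1// ler1n.
  apply: (le_trans (ler_norm_sum _ _ _)).
  apply: (@le_trans _ _ (\sum_(p < N) \sum_(q < N) M * 2^-1 ^+ N * (2^-1 ^+ p * 2^-1 ^+ q))).
    apply: ler_sum => p _; rewrite (bigID (fun q : 'I_N => (p + q < N)%N)) /= addrAC subrr add0r.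
    apply: (le_trans (ler_norm_sum _ _ _)).
    rewrite [leRHS](bigID (fun q : 'I_N => (p + q < N)%N)) /=.
    rewrite ler_wpDl//; first by apply: sumr_ge0 => q _; rewrite !mulr_ge0// exprn_ge0.
    by apply: ler_sum => q; rewrite -leqNgt => /cb.
  under eq_bigr do rewrite -mulr_sumr -mulr_sumr.
  rewrite -mulr_sumr -mulr_suml.
  have g0 : 0 <= \sum_(i < N) 2^-1 ^+ i :> R by apply: sumr_ge0 => i _; rewrite exprn_ge0.
  have g2 : \sum_(i < N) 2^-1 ^+ i <= 2 :> R.
    have := @geom_tail_le R 2^-1 0 N; rewrite big_mkord expr0 mulr1; apply.
    by rewrite lexx invr_ge0 ler0n.
  apply: (@le_trans _ _ (M * 2^-1 ^+ N * (2 * 2))).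
    by rewrite ler_wpM2l ?ler_pM// mulr_ge0// exprn_ge0.
  by rewrite [leRHS](_ : _ = M * 2^-1 ^+ N * (2 * 2))//; ring.
have hxy : `| `|x - y| | < rho.
  rewrite normr_id; apply: (le_lt_trans (ler_normB _ _)); lra.
have h1 := hf _ hxy.
have h0 : (\sum_(p < N) \sum_(q < N) c p q) - pseries a `|x - y| N @[N --> \oo] --> (0 : R).
  apply/cvgr0Pnorm_le => e e0.
  have hg : 4 * M * (2^-1) ^+ N @[N --> \oo] --> (0 : R).
    rewrite -[X in _ --> X](mulr0 (4 * M)); apply: cvgM; first exact: cvg_cst.
    by apply: cvg_expr; rewrite ger0_norm ?invr_ge0// invf_lt1// ltr1n.
  move/cvgr0_norm_le: hg => /(_ _ e0); apply: filterS => N hN.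
  exact: (le_trans (bound N) (le_trans (ler_norm _) hN)).
rewrite (_ : (fun N => _) = ((fun N => (\sum_(p < N) \sum_(q < N) c p q) - pseries a `|x - y| N)
   \+ pseries a `|x - y|)); last by apply/funext => N; rewrite /= subrK.
by rewrite -[f _]add0r; apply: cvgD.
Qed.

Definition const_index (n : nat) : {ffun 'I_1 -> nat} := [ffun=> n].

Lemma mdegree_const n : mdegree (const_index n) = n.
Proof. by rewrite /mdegree big_ord1 ffunE. Qed.

Lemma wronskian_coef_dim1 (R : realType) (a : nat -> R) i j :
  (forall n, odd n -> a n = 0) ->
  wronskian_coef a (const_index i) (const_index j) =
    a (i + j)%N * ((-1) ^+ j * 'C((i + j)%N, i)%:R).
Proof.
move=> hodd; rewrite /wronskian_coef !mdegree_const !big_ord1 !ffunE.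
case: ifP => [_|/negP h]; first by rewrite mulfK ?fact_neq0.
rewrite hodd ?mul0r//; apply/negPn/negP => he; apply: h.
by apply/forallP => l; rewrite !ffunE.
Qed.

Lemma wronskian_dim1_sym (R : realType) (a : nat -> R) i j :
  (forall n, odd n -> a n = 0) ->
  wronskian_coef a (const_index i) (const_index j) =
  wronskian_coef a (const_index j) (const_index i).
Proof.
move=> hodd; rewrite !wronskian_coef_dim1// addnC.
case: (boolP (odd (j + i))) => h; first by rewrite hodd// !mul0r.
have -> : (-1) ^+ j = (-1) ^+ i :> R.
  rewrite -signr_odd -[RHS]signr_odd; congr (_ ^+ nat_of_bool _).
  by move: h; rewrite oddD; case: (odd i); case: (odd j).
by rewrite -(bin_sub (leq_addl j i)) addnK.
Qed.

(** The Hankel matrix of a sequence with a linear recurrence of order K has rank at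
    most K: its rows are combinations of the first K ones. *)
Lemma linear_recurrence_rank (R : realType) (b : nat -> R) K (c : 'I_K -> R) :
  (forall j, b (K + j)%N = \sum_l c l * b (l + j)%N) ->
  exists g : nat -> 'I_K -> R, forall i j, b (i + j)%N = \sum_l g i l * b (l + j)%N.
Proof.
move=> hc; suff h i : exists gi : 'I_K -> R, forall j, b (i + j)%N = \sum_l gi l * b (l + j)%N.
  by have [g hg] := choice h; exists g.
elim/ltn_ind: i => i IH; have [iK|Ki] := ltnP i K.
  exists (fun l => (l == Ordinal iK)%:R) => j.
  rewrite (bigD1 (Ordinal iK))//= eqxx mul1r big1 ?addr0// => l /negPf ->.
  by rewrite mul0r.
have h (l : 'I_K) : exists gl : 'I_K -> R, forall j, b (i - K + l + j)%N = \sum_l gl l * b (l + j)%N.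
  by apply: IH; have := ltn_ord l; lia.
have [g hg] := choice h.
exists (fun m => \sum_l c l * g l m) => j.
have -> : (i + j = K + (i - K + j))%N by lia.
rewrite hc; under [RHS]eq_bigr do rewrite mulr_suml.
rewrite exchange_big; apply: eq_bigr => l _ /=.
have -> : (l + (i - K + j) = i - K + l + j)%N by lia.
by rewrite hg mulr_sumr; apply: eq_bigr => m _; rewrite mulrA.
Qed.

Lemma cvg_sumr (R : realType) (T I : Type) (F : set_system T) (r : seq I) (P : pred I)
    (g : I -> T -> R) (l : I -> R) : Filter F ->
  (forall i, P i -> g i t @[t --> F] --> l i) ->
  (\sum_(i <- r | P i) g i t) @[t --> F] --> \sum_(i <- r | P i) l i.
Proof.
move=> FF h; elim: r => [|i r IH].
  by rewrite big_nil; under eq_cvg do rewrite big_nil; exact: cvg_cst.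
rewrite big_cons; under eq_cvg do rewrite big_cons.
by case: ifP => // Pi; apply: cvgD => //; exact: h.
Qed.

Lemma cvg_prodr (R : realType) (T I : Type) (F : set_system T) (r : seq I) (P : pred I)
    (g : I -> T -> R) (l : I -> R) : Filter F ->
  (forall i, P i -> g i t @[t --> F] --> l i) ->
  (\prod_(i <- r | P i) g i t) @[t --> F] --> \prod_(i <- r | P i) l i.
Proof.
move=> FF h; elim: r => [|i r IH].
  by rewrite big_nil; under eq_cvg do rewrite big_nil; exact: cvg_cst.
rewrite big_cons; under eq_cvg do rewrite big_cons.
by case: ifP => // Pi; apply: cvgM => //; exact: h.
Qed.

Lemma det_cvg (R : realType) n (A : nat -> 'M[R]_n) (B : 'M[R]_n) :
  (forall i j, A N i j @[N --> \oo] --> B i j) -> \det (A N) @[N --> \oo] --> \det B.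
Proof.
move=> h; rewrite /determinant; apply: cvg_sumr => s _.
apply: cvgM; first exact: cvg_cst.
by apply: cvg_prodr => i _.
Qed.

Lemma det_mulmx_thin (R : realType) n m (A : 'M[R]_(n, m)) (B : 'M[R]_(m, n)) :
  (m < n)%N -> \det (A *m B) = 0.
Proof.
move=> mn; apply/eqP; rewrite -[_ == 0]negbK -unitfE -unitmxE -row_free_unit.
rewrite /row_free; apply/negP => /eqP h.
by have := leq_trans (mxrankM_maxl A B) (rank_leq_col A); rewrite h leqNgt mn.
Qed.

Lemma posdefmx_det (R : realType) n (A : 'M[R]_n) : posdefmx A -> \det A != 0.
Proof.
move=> [_ h]; apply/det0P => -[v v0 vA].
by have := h v v0; rewrite vA mul0mx mxE ltxx.
Qed.

(** A positive quadratic form which vanishes at a vector has it in its kernel; this is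
    the one-parameter form of that fact. *)
Lemma quad_zero_kernel (R : realType) (x y : R) :
  (forall t : R, 0 <= 2 * t * x + t ^+ 2 * y) -> x = 0.
Proof.
move=> h; have y0 : 0 <= y by have := h 1; have := h (-1); rewrite sqrrN expr1n; lra.
have y1 : 0 < y + 1 by lra.
have := h (- x / (y + 1)).
have -> : 2 * (- x / (y + 1)) * x + (- x / (y + 1)) ^+ 2 * y = - (x ^+ 2 * (y + 2) / (y + 1) ^+ 2).
  by field; rewrite gt_eqF.
rewrite oppr_ge0 => h1; apply/eqP; rewrite -sqrf_eq0 eq_le sqr_ge0 andbT.
by move: h1; rewrite ler_pdivrMr ?exprn_gt0// mul0r pmulr_lle0//; lra.
Qed.

(** For smooth kernels the Wronskians of all orders are positive semidefinite, so a null vector of one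
    of them, extended by 0, is in the kernel of all larger ones. *)
Lemma wronskian_dim1_row (R : realType) (kappa : 'rV[R]_1 -> 'rV[R]_1 -> R)
    (f : R -> R) (a : nat -> R) (k : nat) (v : nat -> R) :
  pd_kernel kappa -> stationary kappa f -> analytic_at0 f a ->
  smoothness_order a None -> (forall j, (k < j)%N -> v j = 0) ->
  \sum_(i < k.+1) \sum_(j < k.+1)
     v i * v j * wronskian_coef a (const_index i) (const_index j) = 0 ->
  forall be, \sum_(j < k.+1) v j * wronskian_coef a (const_index be) (const_index j) = 0.
Proof.
move=> hpd hst hf hr hv h0 be.
have hodd n : odd n -> a n = 0.
  by move=> hn; apply: (@smooth_odd_coef _ a None n) => //; rewrite leq_pmull.
pose N := maxn k be.
pose W i j := wronskian_coef a (const_index i) (const_index j).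
have wid (F : nat -> R) : (forall j, (k < j)%N -> F j = 0) ->
    \sum_(j < k.+1) F j = \sum_(j < N.+1) F j.
  move=> hF; rewrite (big_ord_widen N.+1 F) ?ltnS ?leq_maxl// big_mkcond.
  by apply: eq_bigr => j _; case: ifP => // /negbT; rewrite -leqNgt => /hF.
have beN : (be < N.+1)%N by rewrite ltnS leq_maxr.
pose S := \sum_(j < N.+1) v j * W be j.
rewrite (wid (fun j => v j * W be j)); last by move=> j kj; rewrite hv// mul0r.
(* the quadratic form at v + t e_be is 2 t S + t^2 W_(be,be) *)
apply: (@quad_zero_kernel _ _ (W be be)) => t.
pose w (j : 'I_N.+1) := v j + t * (j == Ordinal beN)%:R.
have := @wronskian_quad_ge0 R 1 N N.+1 kappa f a None (fun j => const_index j) w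
  hpd hst hf hr isT.
have hd (j : 'I_N.+1) : (mdegree (const_index j) <= N)%N by rewrite mdegree_const -ltnS.
move=> /(_ hd); congr (0 <= _).
have sel (F : nat -> R) : \sum_(j < N.+1) (j == Ordinal beN)%:R * F j = F be.
  rewrite (bigD1 (Ordinal beN))//= eqxx mul1r big1 ?addr0// => j /negPf ->.
  by rewrite mul0r.
have row i : \sum_(j < N.+1) w j * W i j = \sum_(j < N.+1) v j * W i j + t * W i be.
  rewrite -(sel (fun j => W i j)) mulr_sumr -big_split/=.
  by apply: eq_bigr => j _; rewrite mulrDl mulrA.
transitivity (\sum_(i < N.+1) w i * (\sum_(j < N.+1) v j * W i j + t * W i be)).
  apply: eq_bigr => i _; rewrite -row mulr_sumr; apply: eq_bigr => j _.
  by rewrite mulrA.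
transitivity (\sum_(i < N.+1) v i * (\sum_(j < N.+1) v j * W i j + t * W i be)
    + t * (S + t * W be be)).
  rewrite -(sel (fun i => \sum_(j < N.+1) v j * W i j + t * W i be)).
  rewrite mulr_sumr -big_split/=; apply: eq_bigr => i _; rewrite /w; ring.
have -> : \sum_(i < N.+1) v i * (\sum_(j < N.+1) v j * W i j + t * W i be) = t * S.
  under eq_bigr do rewrite mulrDr.
  rewrite big_split /= -[RHS]add0r; congr (_ + _).
    apply: (etrans _ h0).
    rewrite (wid (fun i => \sum_(j < k.+1) v i * v j * W i j)).
      apply: eq_bigr => i _; rewrite (wid (fun j => v i * v j * W i j)).
        by rewrite mulr_sumr; apply: eq_bigr => j _; rewrite mulrA.
      by move=> j kj; rewrite (hv j)// mulr0 mul0r.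
    by move=> j kj; rewrite big1// => i _; rewrite (hv j)// !mul0r.
  rewrite /S mulr_sumr; apply: eq_bigr => i _.
  by rewrite /W wronskian_dim1_sym// mulrCA.
rewrite /S; ring.
Qed.

(** The relation of [wronskian_dim1_row], multiplied by be!, reads
    u_0 b_be + ... + u_K b_(be+K) = 0 with b_n = n! a_n and u_j = (-1)^j v_j / j!.  The truncated kernel
    matrices of K + 1 points thus have rank at most K, and so their limit is
    singular. *)
Lemma wronskian_dim1_nondegenerate (R : realType) (kappa : 'rV[R]_1 -> 'rV[R]_1 -> R)
    (f : R -> R) (a : nat -> R) (k : nat) (v : nat -> R) :
  pd_kernel kappa -> stationary kappa f -> analytic_at0 f a ->
  smoothness_order a None -> (forall j, (k < j)%N -> v j = 0) ->
  \sum_(i < k.+1) \sum_(j < k.+1)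
     v i * v j * wronskian_coef a (const_index i) (const_index j) = 0 ->
  forall j, v j = 0.
Proof.
move=> hpd hst hf hr hv h0 j0; apply/eqP/negPn/negP => vj0.
have hodd n : odd n -> a n = 0.
  by move=> hn; apply: (@smooth_odd_coef _ a None n) => //; rewrite leq_pmull.
have hbd j : v j != 0 -> (j <= k)%N.
  by move=> vj; rewrite leqNgt; apply/negP => /hv e; rewrite e eqxx in vj.
pose K := ex_maxn (ex_intro (fun j => v j != 0) j0 vj0) hbd.
have [vK Kmax] : v K != 0 /\ forall j, v j != 0 -> (j <= K)%N.
  by rewrite /K; case: ex_maxnP => i vi h; split.
have hrow be : \sum_(j < K.+1) v j * wronskian_coef a (const_index be) (const_index j) = 0.
  apply: (etrans _ (wronskian_dim1_row hpd hst hf hr hv h0 be)).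
  rewrite (big_ord_widen k.+1 (fun j => v j * wronskian_coef a (const_index be) (const_index j))).
    rewrite big_mkcond; apply: eq_bigr => j _; case: ifP => // /negbT.
    rewrite -leqNgt => Kj; have [->|/Kmax] := eqVneq (v j) 0; first by rewrite mul0r.
    by rewrite leqNgt Kj.
  by rewrite ltnS hbd.
pose b n : R := (n`!)%:R * a n.
pose u j : R := v j * (-1) ^+ j / (j`!)%:R.
have uK : u K != 0.
  by rewrite /u !mulf_neq0 ?signr_eq0 ?invr_neq0 ?fact_neq0.
have binE p q : ('C((p + q)%N, p))%:R = ((p + q)`!)%:R / ((p`!)%:R * (q`!)%:R) :> R.
  rewrite -(bin_fact (leq_addr q p)) addKn !natrM; field.
  by rewrite !fact_neq0.
have hb be : \sum_(j < K.+1) u j * b (be + j)%N = 0.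
  transitivity ((be`!)%:R * \sum_(j < K.+1) v j * wronskian_coef a (const_index be) (const_index j)).
    rewrite mulr_sumr; apply: eq_bigr => j _.
    rewrite wronskian_coef_dim1// binE /u /b; field.
    by rewrite !fact_neq0.
  by rewrite hrow mulr0.
have hc j : b (K + j)%N = \sum_(l < K) (- u l / u K) * b (l + j)%N.
  have := hb j; rewrite big_ord_recr /= => /eqP; rewrite addr_eq0 => /eqP e.
  apply: (mulfI uK); rewrite -[LHS]opprK addnC -e -sumrN mulr_sumr.
  by apply: eq_bigr => l _; rewrite addnC; field.
have [g hg] := linear_recurrence_rank hc.
have [M [rho [r0 M0 hM hps]]] := analytic_coef_bound hf.
pose y (i : 'I_K.+1) : R := rho / 8 * (i%:R / K.+1%:R).
have hy i : `|y i| <= rho / 8.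
  have h1 : 0 <= i%:R / K.+1%:R :> R by rewrite divr_ge0.
  have h2 : i%:R / K.+1%:R <= 1 :> R.
    by rewrite ler_pdivrMr ?ltr0n// mul1r ler_nat ltnW.
  rewrite ger0_norm; last by rewrite mulr_ge0// divr_ge0// ltW.
  by rewrite ger_pMr ?divr_gt0.
have yi : injective (fun i => const_mx (y i) : 'rV[R]_1).
  move=> i j /(congr1 (fun w : 'rV_1 => w 0 0)); rewrite !mxE => /mulfI.
  have r8 : rho / 8 != 0 by rewrite gt_eqF ?divr_gt0.
  move=> /(_ r8) /divIf; rewrite pnatr_eq0 => /(_ isT) /eqP.
  by rewrite eqr_nat => /eqP e; apply: val_inj.
pose A N : 'M[R]_K.+1 := \matrix_(i, j) \sum_(p < N) \sum_(q < N)
     a (p + q)%N * ((-1) ^+ q * 'C((p + q)%N, p)%:R * y i ^+ p * y j ^+ q).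
have A0 N : \det (A N) = 0.
  pose P : 'M[R]_(K.+1, K) := \matrix_(i, l) \sum_(p < N) g p l * y i ^+ p / (p`!)%:R.
  pose Q : 'M[R]_(K, K.+1) := \matrix_(l, j) \sum_(q < N) b (l + q)%N * (-1) ^+ q * y j ^+ q / (q`!)%:R.
  rewrite -(@det_mulmx_thin _ _ _ P Q (ltnSn K)); congr (\det _).
  apply/matrixP => i j; rewrite !mxE.
  under [RHS]eq_bigr => l _.
    rewrite !mxE mulr_suml; under eq_bigr do rewrite mulr_sumr.
    over.
  rewrite [RHS]exchange_big; apply: eq_bigr => p _ /=.
  rewrite [RHS]exchange_big; apply: eq_bigr => q _ /=.
  transitivity (b (p + q)%N * ((-1) ^+ q * y i ^+ p * y j ^+ q / ((p`!)%:R * (q`!)%:R))).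
    by rewrite binE /b; field; rewrite !fact_neq0.
  rewrite hg mulr_suml; apply: eq_bigr => l _; field.
  by rewrite !fact_neq0.
have hAc : \det (A N) @[N --> \oo] --> \det (kernel_mx kappa (fun i => const_mx (y i))).
  apply: det_cvg => i j; rewrite mxE hst.
  have -> : enorm (const_mx (y i) - const_mx (y j) : 'rV[R]_1) = `|y i - y j|.
    by rewrite /enorm big_ord1 !mxE sqrtr_sqr.
  under eq_cvg do rewrite mxE.
  exact: square_truncation_cvg r0 hM hps hodd (hy i) (hy j).
have := posdefmx_det (hpd _ _ yi); apply/negP/negPn/eqP.
move: hAc; under eq_cvg do rewrite A0.
by move=> /(cvg_unique _) /(_ (cvg_cst _)) <-.
Qed.

(** * The Wronskian is invertible *)

(** Points of a line embed isometrically in the space. *)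
Lemma pd_kernel_line (R : realType) (d : nat) (kappa : 'rV[R]_d -> 'rV[R]_d -> R)
    (f : R -> R) : (0 < d)%N -> pd_kernel kappa -> stationary kappa f ->
  pd_kernel (fun x y : 'rV[R]_1 => f (enorm (x - y))).
Proof.
move=> d0 hpd hst N y yi; pose l0 := Ordinal d0.
pose y' i : 'rV[R]_d := \row_l (if l == l0 then y i 0 0 else 0).
have y'i : injective y'.
  move=> i j /(congr1 (fun v : 'rV_d => v 0 l0)); rewrite !mxE eqxx => e.
  by apply: yi; apply/rowP => l; rewrite ord1.
have -> : kernel_mx (fun x y : 'rV[R]_1 => f (enorm (x - y))) y = kernel_mx kappa y'.
  apply/matrixP => i j; rewrite !mxE hst; congr (f (Num.sqrt _)).
  rewrite big_ord1 (bigD1 l0)//= big1 ?addr0 ?mxE ?eqxx//.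
  by move=> l /negPf ll0; rewrite !mxE ll0 subrr expr0n.
exact: hpd.
Qed.

(** The Wronskian does not couple degrees of different parity, so the part of a kernel
    vector with the parity of its top degree is again a kernel vector. *)
Lemma wronskian_unit_smooth (R : realType) (d k M s : nat)
    (kappa : 'rV[R]_d -> 'rV[R]_d -> R) (f : R -> R) (a : nat -> R)
    (al : 'I_M -> {ffun 'I_d -> nat}) :
  (0 < d)%N -> pd_kernel kappa -> stationary kappa f ->
  analytic_at0 f a -> smoothness_order a (Some s) -> (k <= s - 1)%N ->
  (forall j, (mdegree (al j) <= k)%N) -> injective al ->
  wronskian a al \in unitmx.
Proof.
move=> d0 hpd hst hf hr hk hal alinj.
rewrite unitmxE unitfE; apply/det0P => -[v v0 vW].
have [j1 vj1] : exists j, v 0 j != 0.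
  by apply/existsP; rewrite -negb_forall; apply: contraNN v0 => /forallP h;
     apply/eqP/rowP => j; rewrite mxE; apply/eqP.
pose supp j := v 0 j != 0.
pose j0 := [arg max_(j > j1 | supp j) mdegree (al j)]%N.
have [vj0 hmax] : v 0 j0 != 0 /\ forall j, v 0 j != 0 -> (mdegree (al j) <= mdegree (al j0))%N.
  by rewrite /j0; case: arg_maxnP => // i vi h.
pose w j := if odd (mdegree (al j)) == odd (mdegree (al j0)) then v 0 j else 0.
have /eqP : \sum_i \sum_j w i * w j * wronskian_coef a (al i) (al j) != 0.
  apply: (@wronskian_quad_neq0 R d k M s kappa f a al w j0) => //.
    by rewrite /w eqxx.
  move=> j; rewrite /w; case: ifP => [/eqP oj vj|_]; last by rewrite eqxx.
  by split => //; exact: hmax.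
apply.
rewrite exchange_big big1// => j _ /=.
rewrite {2}/w; case: ifP => oj; last by under eq_bigr do rewrite mulr0 mul0r; rewrite big1.
have := congr1 (fun A : 'rV[R]_M => A 0 j) vW; rewrite !mxE => e.
transitivity (v 0 j * \sum_i v 0 i * wronskian a al i j); last by rewrite e mulr0.
rewrite mulr_sumr; apply: eq_bigr => i _; rewrite mxE /w.
case: ifP => oi; first by ring.
rewrite wronskian_coef_odd ?mulr0// oddD (eqP oj).
by move: oi; case: odd; case: odd.
Qed.

Lemma wronskian_unit_dim1 (R : realType) (k M : nat)
    (kappa : 'rV[R]_1 -> 'rV[R]_1 -> R) (f : R -> R) (a : nat -> R)
    (al : 'I_M -> {ffun 'I_1 -> nat}) :
  pd_kernel kappa -> stationary kappa f ->
  analytic_at0 f a -> smoothness_order a None ->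
  (forall j, (mdegree (al j) <= k)%N) -> injective al ->
  wronskian a al \in unitmx.
Proof.
move=> hpd hst hf hr hal alinj.
have alE j : al j = const_index (mdegree (al j)).
  by apply/ffunP => l; rewrite /mdegree big_ord1 ffunE ord1.
rewrite unitmxE unitfE; apply/det0P => -[v v0 vW].
pose u n := \sum_j v 0 j * (mdegree (al j) == n)%:R.
have hu n : (k < n)%N -> u n = 0.
  move=> kn; rewrite /u big1// => j _.
  by rewrite ltn_eqF ?mulr0// (leq_ltn_trans (hal j)).
have uE j : u (mdegree (al j)) = v 0 j.
  rewrite /u (bigD1 j)//= eqxx mulr1 big1 ?addr0// => i ij.
  case: eqP => [e|_]; last by rewrite mulr0.
  by move: ij; rewrite -(inj_eq alinj) (alE i) e -alE eqxx.
have quad : \sum_(i < k.+1) \sum_(j < k.+1)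
     u i * u j * wronskian_coef a (const_index i) (const_index j) = 0.
  transitivity (\sum_j \sum_i v 0 i * v 0 j * wronskian_coef a (al i) (al j)).
    transitivity (\sum_(p < k.+1) \sum_(q < k.+1) \sum_j \sum_i v 0 i * v 0 j *
      wronskian_coef a (const_index p) (const_index q) *
      ((mdegree (al i) == p)%:R * (mdegree (al j) == q)%:R)).
      apply: eq_bigr => p _; apply: eq_bigr => q _.
      rewrite /u mulr_sumr mulr_suml; apply: eq_bigr => j _.
      by rewrite mulr_suml mulr_suml; apply: eq_bigr => i _; ring.
    under eq_bigr do rewrite exchange_big.
    rewrite exchange_big; apply: eq_bigr => j _ /=.
    under eq_bigr do rewrite exchange_big.
    rewrite exchange_big; apply: eq_bigr => i _ /=.
    have ik : (mdegree (al i) < k.+1)%N by rewrite ltnS.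
    have jk : (mdegree (al j) < k.+1)%N by rewrite ltnS.
    rewrite (bigD1 (Ordinal ik))//= (bigD1 (Ordinal jk))//= !eqxx !mulr1 -!alE.
    rewrite [X in _ + X + _]big1 ?addr0; last first.
      by move=> q jq; rewrite [(mdegree (al j) == q)%N]eq_sym (_ : (nat_of_ord q == _) = false)
         ?mulr0//; apply/negbTE; apply: contraNN jq => /eqP e; apply/eqP/val_inj.
    rewrite big1 ?addr0// => p ip; rewrite big1// => q _.
    rewrite [(mdegree (al i) == p)%N]eq_sym (_ : (nat_of_ord p == _) = false) ?mul0r ?mulr0//.
    by apply/negbTE; apply: contraNN ip => /eqP e; apply/eqP/val_inj.
  rewrite big1// => j _.
  have := congr1 (fun A : 'rV[R]_M => A 0 j) vW; rewrite !mxE => e.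
  transitivity (v 0 j * \sum_i v 0 i * wronskian a al i j); last by rewrite e mulr0.
  by rewrite mulr_sumr; apply: eq_bigr => i _; rewrite mxE; ring.
have u0 := wronskian_dim1_nondegenerate hpd hst hf hr hu quad.
by move/eqP: v0; apply; apply/rowP => j; rewrite mxE -uE u0.
Qed.

(** Two multi-indices of degree at most 1 with an even sum are equal, so the Wronskian
    is diagonal, with entries proportional to a_0 and a_2. *)
Lemma wronskian_unit_degree1 (R : realType) (d M : nat)
    (kappa : 'rV[R]_d -> 'rV[R]_d -> R) (f : R -> R) (a : nat -> R)
    (al : 'I_M -> {ffun 'I_d -> nat}) :
  (0 < d)%N -> pd_kernel kappa -> stationary kappa f ->
  analytic_at0 f a -> smoothness_order a None ->
  (forall j, (mdegree (al j) <= 1)%N) -> injective al ->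
  wronskian a al \in unitmx.
Proof.
move=> d0 hpd hst hf hr hal alinj.
have hpd1 := pd_kernel_line d0 hpd hst.
have hst1 : stationary (fun x y : 'rV[R]_1 => f (enorm (x - y))) f by [].
have hodd n : odd n -> a n = 0.
  by move=> hn; apply: (@smooth_odd_coef _ a None n) => //; rewrite leq_pmull.
(* the unit vector e_n would be a null vector of the Wronskian of the line *)
have a2 n : (n <= 1)%N -> a (n + n)%N != 0.
  move=> n1; apply/eqP => an.
  have h := @wronskian_dim1_nondegenerate R _ f a n (fun j => (j == n)%:R) hpd1 hst1 hf hr.
  have /h : forall j, (n < j)%N -> (j == n)%:R = 0 :> R by move=> j nj; rewrite gtn_eqF.
  have -> : \sum_(i < n.+1) \sum_(j < n.+1) (nat_of_ord i == n)%:R * (nat_of_ord j == n)%:R *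
      wronskian_coef a (const_index i) (const_index j) = 0.
    rewrite big1// => i _; rewrite big1// => j _.
    case: eqP => [->|_]; last by rewrite !mul0r.
    case: eqP => [->|_]; last by rewrite mulr0 mul0r.
    by rewrite wronskian_coef_dim1// an mul0r mulr0.
  move=> /(_ erefl n)/eqP; by rewrite eqxx oner_eq0.
have offdiag i j : i != j -> wronskian_coef a (al i) (al j) = 0.
  move=> ij; rewrite /wronskian_coef; case: ifP => // /forallP hev.
  case/eqP: ij; apply: alinj; apply/ffunP => l.
  have := hev l; have := leq_trans (entry_le_mdegree (al i) l) (hal i).
  have := leq_trans (entry_le_mdegree (al j) l) (hal j).
  by case: (al i l) => [|[]] //; case: (al j l) => [|[]].
have diag i : wronskian_coef a (al i) (al i) != 0.
  rewrite /wronskian_coef ifT; last by apply/forallP => l; rewrite addnn odd_double.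
  rewrite !mulf_neq0 ?a2// ?invr_neq0 ?fact_neq0//.
    by rewrite pnatr_eq0 -lt0n prodn_gt0// => l; rewrite fact_gt0.
  apply/prodf_neq0 => l _; rewrite mulf_neq0 ?signr_eq0// pnatr_eq0 -lt0n bin_gt0.
  exact: leq_addr.
rewrite unitmxE unitfE; apply/det0P => -[v /eqP v0 vW]; apply: v0.
apply/rowP => j; rewrite mxE.
have := congr1 (fun A : 'rV[R]_M => A 0 j) vW; rewrite !mxE (bigD1 j)//= big1 ?addr0.
  by rewrite mxE => /eqP; rewrite mulf_eq0 (negPf (diag j)) orbF => /eqP.
by move=> i ij; rewrite mxE offdiag ?mulr0.
Qed.

Lemma wronskian_unit (R : realType) (d k : nat)
    (kappa : 'rV[R]_d -> 'rV[R]_d -> R) (f : R -> R) (a : nat -> R) (r : option nat)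
    (al : 'I_(polydim k d) -> {ffun 'I_d -> nat}) :
  (0 < d)%N -> pd_kernel kappa -> stationary kappa f ->
  analytic_at0 f a -> smoothness_order a r -> le_order_pred k r ->
  graded_enum al ->
  ((2 <= d)%N -> (2 <= k)%N -> r = None -> wronskian a al \in unitmx) ->
  wronskian a al \in unitmx.
Proof.
move=> d0 hpd hst hf hr hk [alinj alle _] hW.
have hal j : (mdegree (al j) <= k)%N by apply/alle; exists j.
case: r hr hk hW => [s|] hr hk hW; first exact: (wronskian_unit_smooth d0 hpd hst hf hr hk hal alinj).
case: (ltnP 1 k) => [k2|k1]; last first.
  by apply: (wronskian_unit_degree1 d0 hpd hst hf hr) => // j; exact: leq_trans (hal j) k1.
case: (ltnP 1 d) => [d2|d1]; first exact: hW.
have d1' : d = 1%N by apply/eqP; rewrite eqn_leq d1.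
subst d; exact: (wronskian_unit_dim1 hpd hst hf hr hal alinj).
Qed.

(** * Leading term of the minors of the kernel matrix *)

Lemma det_mulmx_expand (R : comNzRingType) n N (B : 'M[R]_(n, N)) (X : 'M[R]_(N, n)) :
  \det (B *m X) = \sum_(g : {ffun 'I_n -> 'I_N}) (\prod_i B i (g i)) * \det (rowsub g X).
Proof.
rewrite /determinant; under [RHS]eq_bigr do rewrite mulr_sumr.
rewrite [RHS]exchange_big; apply: eq_bigr => s _ /=.
under [RHS]eq_bigr do rewrite mulrCA.
rewrite -[RHS]mulr_sumr; congr (_ * _).
under [LHS]eq_bigr do rewrite mxE.
rewrite bigA_distr_bigA; apply: eq_bigr => g _.
by rewrite -big_split; apply: eq_bigr => i _; rewrite !mxE.
Qed.

(** A form of the Cauchy-Binet formula, summed over all maps instead of subsets: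
    non-injective maps contribute 0 ([det_mxsub_noninj]). *)
Lemma det_congr_expand (R : comNzRingType) n N (B : 'M[R]_(n, N)) (C : 'M[R]_N) :
  \det (B *m C *m B^T) = \sum_(g : {ffun 'I_n -> 'I_N}) \sum_(h : {ffun 'I_n -> 'I_N})
    (\prod_i B i (g i)) * (\prod_i B i (h i)) * \det (mxsub g h C).
Proof.
rewrite -mulmxA det_mulmx_expand; apply: eq_bigr => g _.
have -> : rowsub g (C *m B^T) = (B *m (rowsub g C)^T)^T.
  apply/matrixP => i j; rewrite !mxE; apply: eq_bigr => l _; rewrite !mxE; exact: mulrC.
rewrite det_tr det_mulmx_expand mulr_sumr; apply: eq_bigr => h _.
rewrite -mulrA; congr (_ * (_ * _)).
by rewrite -det_tr; congr (\det _); apply/matrixP => i j; rewrite !mxE.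
Qed.

Lemma det_mxsub_noninj (R : comNzRingType) n N (C : 'M[R]_N) (g h : {ffun 'I_n -> 'I_N}) :
  ~~ injectiveb g \/ ~~ injectiveb h -> \det (mxsub g h C) = 0.
Proof.
have key (A : 'M[R]_N) (u w : {ffun 'I_n -> 'I_N}) : ~~ injectiveb u -> \det (mxsub u w A) = 0.
  move=> /injectivePn[i [j ij uij]]; apply: (determinant_alternate ij) => l.
  by rewrite !mxE uij.
case=> hn; first exact: key.
rewrite -det_tr -(key C^T h g hn); congr (\det _).
by apply/matrixP => i j; rewrite !mxE.
Qed.

(** Exponents of t in the columns of [V D | t^(2k+1) I].  The first block carries the
    monomials and the second one absorbs everything beyond degree k; with eps = t^2
    the half-integral exponent k + 1/2 of the second block becomes integral, and it
    is larger than all the exponents of the first block. *)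
Definition col_weight (n k : nat) (w : 'I_n -> nat) (b : 'I_(n + n)) : nat :=
  match fintype.split b with inl j => (2 * w j)%N | inr _ => (2 * k).+1 end.

Lemma col_weight_lshift n k w (j : 'I_n) : col_weight k w (lshift n j) = (2 * w j)%N.
Proof. by rewrite /col_weight; case: fintype.splitP => [i /= /val_inj -> // | i /= e]; have := ltn_ord j; rewrite e; lia. Qed.

Lemma col_weight_rshift n k w (j : 'I_n) : col_weight k w (rshift n j) = (2 * k).+1.
Proof. by rewrite /col_weight; case: fintype.splitP => [i /= e|//]; have := ltn_ord i; rewrite -e; lia. Qed.

(** Exchanging the columns of the second block that are chosen for the columns of the
    first block that are not lowers the weight by at least 1 for each. *)
Lemma col_weight_sum (n k : nat) (w : 'I_n -> nat) (g : {ffun 'I_n -> 'I_(n + n)}) :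
  (forall j, (w j <= k)%N) -> injectiveb g ->
  (2 * \sum_j w j + [exists i, exists j, g i == rshift n j] <= \sum_i col_weight k w (g i))%N.
Proof.
move=> hw /injectiveP gi.
pose T := [set g i | i in 'I_n]%SET; pose Lw := [set lshift n j | j in 'I_n]%SET.
have cT : #|T| = n by rewrite card_imset// card_ord.
have cL : #|Lw| = n by rewrite card_imset ?card_ord//; exact: lshift_inj.
have sT : (\sum_i col_weight k w (g i) = \sum_(b in T) col_weight k w b)%N.
  by rewrite big_imset//= => i j _ _; exact: gi.
have sL : (2 * \sum_j w j = \sum_(b in Lw) col_weight k w b)%N.
  rewrite big_imset/=; last by move=> i j _ _; exact: lshift_inj.
  by rewrite big_distrr; apply: eq_bigr => j _; rewrite col_weight_lshift.
have cc : #|T :\: Lw| = #|Lw :\: T| by rewrite !cardsD finset.setIC cT cL.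
have h1 : (\sum_(b in T :\: Lw) col_weight k w b = #|T :\: Lw| * (2 * k).+1)%N.
  rewrite -sum_nat_const; apply: eq_bigr => b; rewrite inE => /andP[bL _].
  case: (fintype.splitP b) => [j e|j e].
    by move: bL; rewrite (_ : b = lshift n j) ?imset_f//; apply: val_inj.
  by rewrite (_ : b = rshift n j) ?col_weight_rshift//; apply: val_inj.
have h2 : (\sum_(b in Lw :\: T) col_weight k w b <= #|Lw :\: T| * (2 * k))%N.
  rewrite -sum_nat_const; apply: leq_sum => b; rewrite inE => /andP[_ /imsetP[j _ ->]].
  by rewrite col_weight_lshift leq_mul2l hw.
have h3 : ([exists i, exists j, g i == rshift n j] <= #|T :\: Lw|)%N.
  case: existsP => // -[i /existsP[j /eqP e]]; rewrite card_gt0; apply/finset.set0Pn.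
  exists (g i); rewrite inE imset_f// andbT e; apply/negP => /imsetP[l _ /eqP].
  by rewrite eq_rlshift.
have eT := @finset.big_setID _ 0%N addn _ T Lw (col_weight k w).
have eL := @finset.big_setID _ 0%N addn _ Lw T (col_weight k w).
rewrite finset.setIC in eL.
by rewrite sT sL eT eL /= h1 -addnA leq_add2l mulnS addnC leq_add// cc.
Qed.

Lemma col_weight_sum_low (n k : nat) (w : 'I_n -> nat) (g : {ffun 'I_n -> 'I_(n + n)}) :
  injectiveb g -> (forall i, exists j, g i = lshift n j) ->
  (\sum_i col_weight k w (g i) = 2 * \sum_j w j)%N.
Proof.
move=> /injectiveP gi low.
pose T := [set g i | i in 'I_n]%SET; pose Lw := [set lshift n j | j in 'I_n]%SET.
have sT : (\sum_i col_weight k w (g i) = \sum_(b in T) col_weight k w b)%N.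
  by rewrite big_imset//= => i j _ _; exact: gi.
have -> : (2 * \sum_j w j = \sum_(b in Lw) col_weight k w b)%N.
  rewrite big_imset/=; last by move=> i j _ _; exact: lshift_inj.
  by rewrite big_distrr; apply: eq_bigr => j _; rewrite col_weight_lshift.
rewrite sT; suff -> : T = Lw by [].
apply/eqP; rewrite eqEcard; apply/andP; split.
  by apply/fintype.subsetP => b /imsetP[i _ ->]; have [j ->] := low i; rewrite imset_f.
by rewrite !card_imset ?card_ord//; exact: lshift_inj.
Qed.

Lemma graded_enum_sum (R : realType) (d k : nat)
    (al : 'I_(polydim k d) -> {ffun 'I_d -> nat}) (G : {ffun 'I_d -> nat} -> R) :
  graded_enum al ->
  \sum_(be : {ffun 'I_d -> 'I_(2 * k).+1} | (mdegree (unbox be) <= k)%N) G (unbox be) =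
  \sum_p G (al p).
Proof.
move=> [alinj alle _]; set B := (2 * k)%N.
have kB : (k <= B)%N by rewrite leq_pmull.
have hal p : (mdegree (al p) <= B)%N by apply: leq_trans kB; apply/alle; exists p.
pose h p := box B (al p).
have hinj : injective h.
  by move=> p q e; apply: alinj; rewrite -(boxK (hal p)) -[LHS]/(unbox (h p)) e boxK.
transitivity (\sum_(be in [set h p | p in 'I_(polydim k d)]%SET) G (unbox be)).
  apply: eq_bigl => be; apply/idP/imsetP => [hbe|[p _ ->]].
    have [p e] := (alle (unbox be)).1 hbe.
    by exists p => //; rewrite /h e unboxK.
  by rewrite boxK//; apply/alle; exists p.
rewrite big_imset/=; last by move=> p q _ _; exact: hinj.
by apply: eq_bigr => p _; rewrite boxK.
Qed.

(** Two degrees with sum at most 2k are not both greater than k. *)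
Lemma split_low_high (R : realType) (T : finType) (deg : T -> nat) (k : nat)
    (F : T -> T -> R) :
  \sum_al \sum_(be | (deg al + deg be <= 2 * k)%N) F al be =
  \sum_(al | (deg al <= k)%N) \sum_(be | (deg be <= k)%N) F al be +
  \sum_(al | (deg al <= k)%N)
    \sum_(be | (k < deg be)%N && (deg al + deg be <= 2 * k)%N) F al be +
  \sum_(be | (deg be <= k)%N)
    \sum_(al | (k < deg al)%N && (deg al + deg be <= 2 * k)%N) F al be.
Proof.
rewrite (bigID (fun al => (deg al <= k)%N)) /=; congr (_ + _).
  rewrite -big_split; apply: eq_bigr => al hal /=.
  rewrite (bigID (fun be => (deg be <= k)%N)) /=; congr (_ + _); apply: eq_bigl => be; lia.
rewrite (exchange_big_dep (fun be => (deg be <= k)%N)) /=; last by move=> al be; lia.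
by apply: eq_bigr => be hbe; apply: eq_bigl => al; lia.
Qed.

(** The blocks of the middle matrix are W, the Taylor terms in which one of the two
    degrees exceeds k, and the remainder, each divided by the powers of t carried by
    the outer factors.  They are bounded, so in the expansion of the determinant a
    choice of columns outside the first block leaves a factor t, and the other
    choices reassemble into the determinant of V W V^T. *)
Lemma kernel_det_order (R : realType) (d k : nat) (f : R -> R) (a : nat -> R)
    (r : option nat) (al : 'I_(polydim k d) -> {ffun 'I_d -> nat})
    (y : 'I_(polydim k d) -> 'rV[R]_d) :
  analytic_at0 f a -> smoothness_order a r -> le_order_pred k r -> graded_enum al ->
  order_at0 1 (fun t =>
    \det (\matrix_(i, j) f (t ^+ 2 * enorm (y i - y j)) : 'M[R]_(polydim k d))
      / t ^+ (4 * \sum_j mdegree (al j))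
    - \det (vandermonde y al) ^+ 2 * \det (wronskian a al)).
Proof.
move=> hf hr hk hal; have [_ alle _] := hal.
have halk j : (mdegree (al j) <= k)%N by apply/alle; exists j.
set n := polydim k d in al y hal alle halk *.
set V := vandermonde y al; set W := wronskian a al.
set S := (\sum_j mdegree (al j))%N.
pose A := {ffun 'I_d -> 'I_(2 * k).+1}.
pose deg (be : A) := mdegree (unbox be).
pose m i (be : A) := monomial (y i) (unbox be).
pose Ta (h : R) i j := \sum_(ga : A) \sum_(be : A | (deg ga + deg be <= 2 * k)%N)
  wronskian_coef a (unbox ga) (unbox be) * h ^+ (deg ga + deg be) * m i ga * m j be.
(* degree of the left monomial at most k, of the right one greater than k; the
   weight of the second block is t^(2k+1), hence the shift of the exponent *)
pose U1 t : 'M[R]_n := \matrix_(p, j) \sum_(be : A | (k < deg be)%N && (mdegree (al p) + deg be <= 2 * k)%N)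
  (wronskian_coef a (al p) (unbox be) * m j be) * t ^+ (2 * deg be - (2 * k).+1).
pose U2 t : 'M[R]_n := \matrix_(i, q) \sum_(ga : A | (k < deg ga)%N && (deg ga + mdegree (al q) <= 2 * k)%N)
  (wronskian_coef a (unbox ga) (al q) * m i ga) * t ^+ (2 * deg ga - (2 * k).+1).
pose E t : 'M[R]_n := \matrix_(i, j)
  ((f (t ^+ 2 * enorm (y i - y j)) - Ta (t ^+ 2) i j) / t ^+ (2 * (2 * k).+1)).
pose Mid t : 'M[R]_(n + n) := block_mx W (U1 t) (U2 t) (E t).
pose B0 : 'M[R]_(n, n + n) := row_mx V 1%:M.
pose B1 : 'M[R]_(n, n + n) := row_mx V 0.
pose cw := col_weight k (fun j => mdegree (al j)).
pose B t : 'M[R]_(n, n + n) := \matrix_(i, b) (B0 i b * t ^+ cw b).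
(* [B1] is the limit of the rescaled outer factor: only the first block survives *)
have hMid i j : order_at0 0 (fun t => Mid t i j).
  rewrite /Mid; case: (fintype.splitP i) => i' ei; case: (fintype.splitP j) => j' ej.
  - have -> : i = lshift n i' by apply: val_inj.
    have -> : j = lshift n j' by apply: val_inj.
    apply: (order_at0_near _ (order_at0_cst (W i' j'))).
    by near=> t; rewrite block_mxEul.
  - have -> : i = lshift n i' by apply: val_inj.
    have -> : j = rshift n j' by apply: val_inj.
    have ho : order_at0 0 (fun t => U1 t i' j').
      under eq_fun do rewrite mxE.
      by apply: order_at0_sum => be _; apply: order_at0Z; apply: (order_at0W (leq0n _) (order_at0X R _)).
    by apply: (order_at0_near _ ho); near=> t; rewrite block_mxEur.
  - have -> : i = rshift n i' by apply: val_inj.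
    have -> : j = lshift n j' by apply: val_inj.
    have ho : order_at0 0 (fun t => U2 t i' j').
      under eq_fun do rewrite mxE.
      by apply: order_at0_sum => be _; apply: order_at0Z; apply: (order_at0W (leq0n _) (order_at0X R _)).
    by apply: (order_at0_near _ ho); near=> t; rewrite block_mxEdl.
  - have -> : i = rshift n i' by apply: val_inj.
    have -> : j = rshift n j' by apply: val_inj.
    have ho : order_at0 0 (fun t => (f (t ^+ 2 * enorm (y i' - y j')) - Ta (t ^+ 2) i' j')
        / t ^+ (2 * (2 * k).+1)).
      apply: order_at0_divX; rewrite addn0.
      apply: (@order_at0_comp _ (2 * k).+1 2 (fun h => f (h * enorm (y i' - y j')) - Ta h i' j')) => //.
      exact: kernel_taylor hf hr hk.
    by apply: (order_at0_near _ ho); near=> t; rewrite block_mxEdr mxE.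
have fact t : t != 0 -> \matrix_(i, j) f (t ^+ 2 * enorm (y i - y j)) = B t *m Mid t *m (B t)^T.
  move=> t0.
  pose VD : 'M[R]_n := \matrix_(i, p) (V i p * t ^+ (2 * mdegree (al p))).
  have -> : B t = row_mx VD ((t ^+ (2 * k).+1)%:M).
    apply/matrixP => i b; rewrite mxE /B0 /cw.
    case: (fintype.splitP b) => b' eb.
      have -> : b = lshift n b' by apply: val_inj.
      by rewrite !row_mxEl col_weight_lshift [RHS]mxE.
    have -> : b = rshift n b' by apply: val_inj.
    by rewrite !row_mxEr col_weight_rshift !mxE mulr_natl.
  rewrite /Mid mul_row_block tr_row_mx mul_row_col tr_scalar_mx.
  rewrite !mul_mx_scalar !mul_scalar_mx mulmxDl.
  apply/matrixP => i j; rewrite !mxE.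
  transitivity (Ta (t ^+ 2) i j + t ^+ (2 * k).+1 * (t ^+ (2 * k).+1 *
      ((f (t ^+ 2 * enorm (y i - y j)) - Ta (t ^+ 2) i j) / t ^+ (2 * (2 * k).+1)))).
    have -> : t ^+ (2 * (2 * k).+1) = t ^+ (2 * k).+1 * t ^+ (2 * k).+1.
      by rewrite -exprD addnn mul2n.
    have : t ^+ (2 * k).+1 != 0 by rewrite expf_neq0.
    move: (t ^+ (2 * k).+1) (f _) (Ta _ _ _) => u F T u0; by field.
  rewrite [in RHS]mulrDr [RHS]addrA; congr (_ + _).
  rewrite /Ta (split_low_high deg k).
  rewrite (graded_enum_sum (fun ga => \sum_(be : A | (deg be <= k)%N)
    wronskian_coef a ga (unbox be) * (t ^+ 2) ^+ (mdegree ga + deg be) * monomial (y i) ga * m j be) hal).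
  rewrite (graded_enum_sum (fun ga => \sum_(be : A | (k < deg be)%N && (mdegree ga + deg be <= 2 * k)%N)
    wronskian_coef a ga (unbox be) * (t ^+ 2) ^+ (mdegree ga + deg be) * monomial (y i) ga * m j be) hal).
  rewrite (graded_enum_sum (fun be => \sum_(ga : A | (k < deg ga)%N && (deg ga + mdegree be <= 2 * k)%N)
    wronskian_coef a (unbox ga) be * (t ^+ 2) ^+ (deg ga + mdegree be) * m i ga * monomial (y j) be) hal).
  rewrite -!addrA; congr (_ + _).
    under [LHS]eq_bigr => p _.
      rewrite (graded_enum_sum (fun be => wronskian_coef a (al p) be *
        (t ^+ 2) ^+ (mdegree (al p) + mdegree be) * monomial (y i) (al p) * monomial (y j) be) hal).
      over.
    rewrite exchange_big; apply: eq_bigr => q _ /=.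
    rewrite !mxE mulr_suml; apply: eq_bigr => p _; rewrite !mxE.
    rewrite exprD -!exprM /monomial; ring.
  have odd2 (x : nat) : (k < x)%N -> (2 * x = (2 * k).+1 + (2 * x - (2 * k).+1))%N by lia.
  have odd3 (p x : nat) : (k < x)%N ->
      (t ^+ 2) ^+ (p + x) = t ^+ (2 * k).+1 * (t ^+ (2 * p) * t ^+ (2 * x - (2 * k).+1)).
    by move=> kx; rewrite -exprM mulnDr exprD [in t ^+ (2 * x)]odd2// exprD mulrCA.
  rewrite [in RHS]addrC -?addrA; congr (_ + _).
    rewrite mulr_sumr; apply: eq_bigr => p _; rewrite [VD i p]mxE [U1 t p j]mxE [V i p]mxE.
    rewrite mulr_sumr mulr_sumr; apply: eq_bigr => be /andP[kb _].
    rewrite odd3// /monomial; ring.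
  apply: eq_bigr => p _; rewrite [VD^T p j]mxE [VD j p]mxE [V j p]mxE !mxE.
  rewrite mulr_sumr mulr_suml; apply: eq_bigr => ga /andP[kb _].
  rewrite addnC odd3// /monomial; ring.
have hdet t : \det V ^+ 2 * \det W = \det (B1 *m Mid t *m B1^T).
  rewrite /Mid /B1 mul_row_block tr_row_mx mul_row_col !mul0mx !addr0 trmx0 mulmx0 addr0.
  by rewrite !det_mulmx det_tr; ring.
pose term t (g h : {ffun 'I_n -> 'I_(n + n)}) : R :=
  ((\prod_i B t i (g i)) * (\prod_i B t i (h i)) / t ^+ (4 * S)
   - (\prod_i B1 i (g i)) * (\prod_i B1 i (h i))) * \det (mxsub g h (Mid t)).
have ho : order_at0 1 (fun t => \sum_(g : {ffun 'I_n -> 'I_(n + n)})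
    \sum_(h : {ffun 'I_n -> 'I_(n + n)}) term t g h).
  apply: order_at0_sum => g _; apply: order_at0_sum => h _.
  have zero (F : R -> R) : (\forall t \near 0^'+, F t = 0) -> order_at0 1 F.
    by move=> F0; exists 0; near=> t; rewrite (near F0 t)// normr0 mul0r.
  case: (boolP (injectiveb g)) => gi; last first.
    by apply: zero; near=> t; rewrite /term det_mxsub_noninj ?mulr0//; left.
  case: (boolP (injectiveb h)) => hi; last first.
    by apply: zero; near=> t; rewrite /term det_mxsub_noninj ?mulr0//; right.
  have hdetM : order_at0 0 (fun t => \det (mxsub g h (Mid t))).
    by apply: order_at0_det => i j; under eq_fun do rewrite mxE.
  have prodB t (u : {ffun 'I_n -> 'I_(n + n)}) :
      \prod_i B t i (u i) = (\prod_i B0 i (u i)) * t ^+ (\sum_i cw (u i)).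
    under eq_bigr do rewrite mxE; rewrite big_split/=; congr (_ * _).
    by rewrite prodrXr.
  pose hgh (u : {ffun 'I_n -> 'I_(n + n)}) := [exists i, exists j, u i == rshift n j].
  have wu (u : {ffun 'I_n -> 'I_(n + n)}) : injectiveb u -> (2 * S + hgh u <= \sum_i cw (u i))%N.
    by move=> ui; apply: col_weight_sum.
  have B1high (u : {ffun 'I_n -> 'I_(n + n)}) : hgh u -> \prod_i B1 i (u i) = 0.
    move=> /existsP[i /existsP[j /eqP e]].
    by rewrite (bigD1 i)//= e row_mxEr mxE mul0r.
  have Blow (u : {ffun 'I_n -> 'I_(n + n)}) : ~~ hgh u -> (\prod_i B0 i (u i) = \prod_i B1 i (u i)) /\
      (forall i, exists j, u i = lshift n j).
    move=> nu; have low i : exists j, u i = lshift n j.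
      case: (fintype.splitP (u i)) => j e; first by exists j; apply: val_inj.
      case/negP: nu; apply/existsP; exists i; apply/existsP; exists j; apply/eqP.
      exact: val_inj.
    split => //; apply: eq_bigr => i _; have [j ->] := low i.
    by rewrite /B0 /B1 !row_mxEl.
  (* when both choices stay in the first block, the two products agree exactly *)
  case: (boolP (hgh g || hgh h)) => hh; last first.
    move: hh; rewrite negb_or => /andP[/Blow[eg lg] /Blow[eh lh]].
    apply: zero; near=> t.
    have t0 : t != 0 by rewrite gt_eqF//; near: t; exact: nbhs_right_gt.
    rewrite /term !prodB eg eh /cw !col_weight_sum_low// -/S.
    rewrite mulrACA -exprD -mulnDl -[(2 + 2)%N]/4%N.
    by rewrite mulfK ?subrr ?mul0r// expf_neq0.
  have hlt : (4 * S + 1 <= \sum_i cw (g i) + \sum_i cw (h i))%N.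
    have := wu g gi; have := wu h hi; move: hh.
    by case: (hgh g); case: (hgh h) => //=; lia.
  pose c := (\prod_i B0 i (g i)) * (\prod_i B0 i (h i)).
  have hc : order_at0 1 (fun t => c * (t ^+ (\sum_i cw (g i) + \sum_i cw (h i)) / t ^+ (4 * S))
      * \det (mxsub g h (Mid t))).
    apply: (@order_at0M _ 1 0) => //; apply: order_at0Z; apply: order_at0_divX.
    exact: (order_at0W hlt (order_at0X R _)).
  apply: (order_at0_near _ hc); near=> t.
  rewrite /term !prodB.
  have -> : (\prod_i B1 i (g i)) * (\prod_i B1 i (h i)) = 0.
    by case/orP: hh => /B1high ->; rewrite ?mul0r ?mulr0.
  by rewrite subr0 /c exprD; ring.
apply: (order_at0_near _ ho); near=> t.
have t0 : t != 0 by rewrite gt_eqF//; near: t; exact: nbhs_right_gt.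
rewrite (hdet t) fact// !det_congr_expand mulr_suml -sumrB.
apply: eq_bigr => g _; rewrite mulr_suml -sumrB; apply: eq_bigr => h _.
by rewrite /term; ring.
Unshelve. all: by end_near. Qed.

(** * Limits of fixed-size L-ensembles *)

(** Stated with an arbitrary number [p] to move from the size #|X| to the size of the
    Vandermonde matrix. *)
Lemma principal_submx_det (R : realType) (n p : nat) (X : {set 'I_n})
    (e : #|X| = p) : exists phi : 'I_p -> 'I_n, injective phi /\
  forall L : 'M[R]_n, \det (principal_submx L X) = \det (mxsub phi phi L).
Proof.
case: p / e; exists enum_val; split; first exact: enum_val_inj.
by move=> L; congr (\det _); apply/matrixP => i j; rewrite !mxE.
Qed.

Lemma minor_cvg (R : realType) (d n k : nat) (f : R -> R) (a : nat -> R)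
    (r : option nat) (x : 'I_n -> 'rV[R]_d)
    (al : 'I_(polydim k d) -> {ffun 'I_d -> nat}) (X : {set 'I_n}) :
  analytic_at0 f a -> smoothness_order a r -> le_order_pred k r -> graded_enum al ->
  #|X| = polydim k d ->
  \det (principal_submx (kernel_mx (scaled_kernel f eps) x) X)
     / Num.sqrt eps ^+ (4 * \sum_j mdegree (al j)) @[eps --> 0^'+] -->
  \det (wronskian a al) *
     \det (principal_submx (vandermonde x al *m (vandermonde x al)^T) X).
Proof.
move=> hf hr hk hal hX.
have [phi [_ hphi]] := principal_submx_det R hX.
have hV : \det (principal_submx (vandermonde x al *m (vandermonde x al)^T) X) =
    \det (vandermonde (x \o phi) al) ^+ 2.
  rewrite hphi expr2 -[X in _ = _ * X]det_tr -det_mulmx; congr (\det _).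
  by apply/matrixP => i j; rewrite !mxE; apply: eq_bigr => l _; rewrite !mxE.
have h := order_at0_cvg (kernel_det_order (x \o phi) hf hr hk hal).
rewrite mulrC hV; have := cvg_comp _ _ (@sqrt_cvg0 R) h; apply: cvg_trans.
apply: near_eq_cvg; near=> eps.
have e0 : 0 < eps by near: eps; exact: nbhs_right_gt.
rewrite /= hphi; congr (\det _ / _); apply/matrixP => i j; rewrite !mxE.
by rewrite /scaled_kernel sqr_sqrtr// ltW.
Unshelve. all: by end_near. Qed.

(** The total mass 1 determines the constant of proportionality, and its inverse is the
    sum of the minors. *)
Lemma ensemble_normalized (R : realType) n m (L : 'M[R]_n) (p : {set 'I_n} -> R) :
  fixed_size_L_ensemble m L p ->
  \sum_(Y : {set 'I_n} | #|Y| == m) \det (principal_submx L Y) != 0 /\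
  forall X : {set 'I_n}, #|X| = m -> p X = \det (principal_submx L X) /
    \sum_(Y : {set 'I_n} | #|Y| == m) \det (principal_submx L Y).
Proof.
move=> [[_ p1] [c hc]].
have e : c * \sum_(Y : {set 'I_n} | #|Y| == m) \det (principal_submx L Y) = 1.
  rewrite -p1 mulr_sumr big_mkcond; apply: eq_bigr => Y _.
  by rewrite hc; case: ifP.
have z0 : \sum_(Y : {set 'I_n} | #|Y| == m) \det (principal_submx L Y) != 0.
  by apply/eqP => z; move/eqP: e; rewrite z mulr0 eq_sym oner_eq0.
split => // X hX; rewrite hc ifT ?hX//; apply: (mulIf z0).
by rewrite mulrAC e mul1r divfK.
Qed.

Lemma ensemble_scale (R : realType) n m (L L' : 'M[R]_n) (b : R) (p : {set 'I_n} -> R) :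
  (forall X : {set 'I_n}, #|X| = m ->
     \det (principal_submx L X) = b * \det (principal_submx L' X)) ->
  fixed_size_L_ensemble m L p -> fixed_size_L_ensemble m L' p.
Proof.
move=> h [hl [c hc]]; split => //; exists (c * b) => X; rewrite hc.
by case: eqP => // hX; rewrite h// mulrA.
Qed.

Lemma thin_minor0 (R : realType) n q m (Q : 'M[R]_(n, q)) (C : 'M[R]_q) (X : {set 'I_n}) :
  #|X| = m -> (q < m)%N -> \det (principal_submx (Q *m C *m Q^T) X) = 0.
Proof.
move=> hX qm; have [phi [_ ->]] := principal_submx_det R hX.
by rewrite -mulmxA mxsub_mul det_mulmx_thin.
Qed.

Lemma square_minor (R : realType) n m (Q : 'M[R]_(n, m)) (C : 'M[R]_m) (X : {set 'I_n}) :
  #|X| = m -> \det (principal_submx (Q *m C *m Q^T) X) =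
     \det C * \det (principal_submx (Q *m Q^T) X).
Proof.
move=> hX; have [phi [_ hphi]] := principal_submx_det R hX.
rewrite !hphi !mxsub_mul [mxsub id id C]mxsub_id !det_mulmx.
ring.
Qed.

(** The rank of [V] is [q].  If q < m, all minors of size m vanish and neither law
    exists; if q = m, the change of basis between [Q] and [V] is invertible. *)
Lemma ensemble_orthonormal (R : realType) n q m (Q : 'M[R]_(n, q)) (V : 'M[R]_(n, m))
    (p : {set 'I_n} -> R) :
  orthonormal_basis_of_colspan Q V ->
  fixed_size_L_ensemble m (V *m V^T) p <-> fixed_size_L_ensemble m (Q *m Q^T) p.
Proof.
move=> [QQ /andP[QV VQ]].
have [D eD] := submxP VQ.
have VE : V *m V^T = Q *m (D^T *m D) *m Q^T.
  have eV : V = Q *m D^T by apply: trmx_inj; rewrite eD trmx_mul trmxK.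
  by rewrite {1}eV eD !mulmxA.
have rQ : \rank Q^T = q.
  apply/eqP; rewrite eqn_leq rank_leq_row /=.
  by have := mxrankM_maxl Q^T Q; rewrite QQ mxrank1.
have rVQ : \rank V^T = q.
  by rewrite -rQ; apply/eqP; rewrite eqn_leq !mxrankS.
have qm : (q <= m)%N by rewrite -rVQ rank_leq_row.
have thin L : (forall X : {set 'I_n}, #|X| = m -> \det (principal_submx L X) = 0) ->
    ~ fixed_size_L_ensemble m L p.
  move=> h /ensemble_normalized[/eqP z _]; apply: z.
  by rewrite big1// => X /eqP; exact: h.
case: (ltnP q m) => [qm'|mq].
  split => [|] /thin [] X hX; first by rewrite VE (thin_minor0 _ _ hX).
  by rewrite -[Q in Q *m _]mulmx1 (thin_minor0 _ _ hX).
have eqm : q = m by apply/eqP; rewrite eqn_leq qm.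
subst m.
have Du : D \in unitmx.
  rewrite -row_free_unit /row_free eqn_leq rank_leq_row /=.
  by rewrite -{1}rVQ eD mxrankM_maxl.
have b0 : \det (D^T *m D) != 0.
  by rewrite det_mulmx det_tr mulf_neq0 // -unitfE -unitmxE.
split; [apply: (@ensemble_scale _ _ _ _ _ (\det (D^T *m D))) => X hX
       |apply: (@ensemble_scale _ _ _ _ _ (\det (D^T *m D))^-1) => X hX].
  by rewrite VE square_minor.
by rewrite VE square_minor// mulrA mulVf ?mul1r.
Qed.

Theorem theorem5p1 (R : realType) (d n : nat) (hd : (1 <= d)%N)
    (x : 'I_n -> 'rV[R]_d) (hx : injective x)
    (kappa : 'rV[R]_d -> 'rV[R]_d -> R) (f : R -> R) (a : nat -> R)
    (r : option nat)
    (hpd : pd_kernel kappa) (hstat : stationary kappa f)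
    (hf : analytic_at0 f a) (hr : smoothness_order a r)
    (m k : nat) (hk : le_order_pred k r) (hm : m = polydim k d)
    (hmn : (m <= n)%N)
    (alpha : 'I_(polydim k d) -> {ffun 'I_d -> nat}) (halpha : graded_enum alpha)
    (hW : (2 <= d)%N -> (2 <= k)%N -> r = None -> wronskian a alpha \in unitmx)
    (p : R -> {set 'I_n} -> R)
    (hp : forall eps : R, 0 < eps ->
       fixed_size_L_ensemble m (kernel_mx (scaled_kernel f eps) x) (p eps)) :
  let V := vandermonde x alpha in
  (forall pstar : {set 'I_n} -> R,
     fixed_size_L_ensemble m (V *m V^T) pstar ->
     forall X : {set 'I_n}, p eps X @[eps --> 0^'+] --> pstar X)
  /\
  (forall (q : nat) (Q : 'M[R]_(n, q)), orthonormal_basis_of_colspan Q V ->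
     forall pstar : {set 'I_n} -> R,
       fixed_size_L_ensemble m (V *m V^T) pstar <->
       fixed_size_L_ensemble m (Q *m Q^T) pstar).
Proof.
move=> V; subst m; split; last first.
  by move=> q Q hQ pstar; exact: ensemble_orthonormal.
move=> pstar hstar X.
have [hX|hX] := eqVneq #|X| (polydim k d); last first.
  have -> : pstar X = 0 by have [_ [c ->]] := hstar; rewrite (negPf hX).
  apply: (@cvg_trans _ ((fun=> 0 : R) @ 0^'+)); last exact: cvg_cst.
  apply: near_eq_cvg; near=> eps.
  have e0 : 0 < eps by near: eps; exact: nbhs_right_gt.
  by have [_ [c ->]] := hp eps e0; rewrite (negPf hX).
have hWu : \det (wronskian a alpha) != 0.
  by rewrite -unitfE -unitmxE; exact: (wronskian_unit hd hpd hstat hf hr hk halpha hW).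
have [z0 ->//] := ensemble_normalized hstar.
pose tau eps : R := Num.sqrt eps ^+ (4 * \sum_j mdegree (alpha j)).
pose D eps (Y : {set 'I_n}) := \det (principal_submx (kernel_mx (scaled_kernel f eps) x) Y).
have hD (Y : {set 'I_n}) : #|Y| = polydim k d -> D eps Y / tau eps @[eps --> 0^'+] -->
    \det (wronskian a alpha) * \det (principal_submx (V *m V^T) Y).
  exact: minor_cvg hf hr hk halpha.
have hZ : \sum_(Y : {set 'I_n} | #|Y| == polydim k d) (D eps Y / tau eps) @[eps --> 0^'+] -->
    \det (wronskian a alpha) *
    \sum_(Y : {set 'I_n} | #|Y| == polydim k d) \det (principal_submx (V *m V^T) Y).
  by rewrite mulr_sumr; apply: cvg_sumr => Y /eqP; exact: hD.
(* both the numerator and the normalizing sum are divided by eps^(2S) *)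
have hlim : (D eps X / tau eps) /
     (\sum_(Y : {set 'I_n} | #|Y| == polydim k d) (D eps Y / tau eps)) @[eps --> 0^'+] -->
    \det (wronskian a alpha) * \det (principal_submx (V *m V^T) X) /
    (\det (wronskian a alpha) *
     \sum_(Y : {set 'I_n} | #|Y| == polydim k d) \det (principal_submx (V *m V^T) Y)).
  by apply: cvgM (hD X hX) _; apply: cvgV hZ; exact: mulf_neq0.
have -> : \det (principal_submx (V *m V^T) X) /
    \sum_(Y : {set 'I_n} | #|Y| == polydim k d) \det (principal_submx (V *m V^T) Y) =
  \det (wronskian a alpha) * \det (principal_submx (V *m V^T) X) /
   (\det (wronskian a alpha) *
    \sum_(Y : {set 'I_n} | #|Y| == polydim k d) \det (principal_submx (V *m V^T) Y)).
  by rewrite invfM mulrACA divff// mul1r.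
apply: cvg_trans hlim; apply: near_eq_cvg; near=> eps.
have e0 : 0 < eps by near: eps; exact: nbhs_right_gt.
have [ze ->//] := ensemble_normalized (hp eps e0).
have t0 : tau eps != 0 by rewrite expf_neq0// sqrtr_eq0 -ltNge.
rewrite /= -mulr_suml -/(D eps X) invfM invrK.
by rewrite mulrACA mulVf// mulr1.
Unshelve. all: by end_near. Qed.
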